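(* Let $d\ge 1$ be an integer. For any $s\in(0,d)$ there exists a compact subset $E\subseteq[0,1]^d$ such that $\dim_H E=\dim_B E=s$ and $E$ has the following properties: (i) $\mathbb{Q}\subseteq\{\xi\in\mathbb{R}: \dim_B(E+\xi E)=\dim_B E\}\subsetneq\mathbb{R}$; (ii) the set $\{\xi\in\mathbb{R}: \dim(E+\xi E)=\dim E\}$ is not a subfield of $\mathbb{R}$ when $\dim$ denotes the Hausdorff dimension, and likewise it is not a subfield of $\mathbb{R}$ when $\dim$ denotes the lower box dimension.
   Context: For $E,F\subset\mathbb{R}^d$, $E+F=\{x+y: x\in E, y\in F\}$, and for $\xi\in\mathbb{R}$, $\xi E=\{\xi x: x\in E\}$. $\dim_H$ denotes Hausdorff dimension. For $\delta>0$, $N_\delta(E)$ is the smallest number of balls of diameter $\delta$ that cover $E$. The lower and upper box dimensions are $\underline{\dim}_B E=\liminf_{\delta\to 0}\frac{\log N_\delta(E)}{-\log\delta}$ and $\overline{\dim}_B E=\limsup_{\delta\to 0}\frac{\log N_\delta(E)}{-\log\delta}$. If they coincide, the box dimension $\dim_B E$ exists and is the common value; the condition $\dim_B(E+\xi E)=\dim_B E$ means that the box dimension of $E+\xi E$ exists and equals $\dim_B E$. *)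

(* Defs.v *)
From HB Require Import structures.
From mathcomp Require Import all_boot all_order all_algebra.
From mathcomp Require Import all_classical all_reals all_analysis.

Set Implicit Arguments.
Unset Strict Implicit.
Unset Printing Implicit Defensive.

Import Order.TTheory GRing.Theory Num.Theory.
Import numFieldNormedType.Exports.

Local Open Scope classical_set_scope.
Local Open Scope ring_scope.

(* The library norm on 'rV[R]_d is the sup norm: it induces the usual topology,
   but diameters and balls below use the Euclidean distance. *)
Definition eucl_dist (R : realType) (d : nat) (x y : 'rV[R]_d) : R :=
  Num.sqrt (\sum_(i < d) (x 0 i - y 0 i) ^+ 2).

Definition eucl_closed_ball (R : realType) (d : nat) (c : 'rV[R]_d) (r : R) :
    set 'rV[R]_d :=
  [set x | eucl_dist c x <= r].

Definition unit_cube (R : realType) (d : nat) : set 'rV[R]_d :=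
  [set x | forall i : 'I_d, 0 <= x 0 i <= 1].

Definition set_sum (R : realType) (d : nat) (E F : set 'rV[R]_d) :
    set 'rV[R]_d :=
  [set x + y | x in E & y in F].

Definition set_scale (R : realType) (d : nat) (xi : R) (E : set 'rV[R]_d) :
    set 'rV[R]_d :=
  [set xi *: x | x in E].

(* Adding 0 to the set only affects the diameter of set0, which is 0. *)
Definition diam (R : realType) (d : nat) (U : set 'rV[R]_d) : \bar R :=
  ereal_sup ([set 0%E] `|` [set (eucl_dist x y)%:E | x in U & y in U]).

(* diam(U)^s, with the convention that the empty set contributes 0 even when s = 0;
   a nonempty set of diameter 0 contributes 0 `^ 0 = 1 when s = 0. *)
Definition diam_pow (R : realType) (d : nat) (s : R) (U : set 'rV[R]_d) :
    \bar R :=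
  if U == set0 then 0%E else poweR (diam U) s.

Definition hausdorff_premeasure (R : realType) (d : nat) (s delta : R)
    (E : set 'rV[R]_d) : \bar R :=
  ereal_inf [set (\sum_(0 <= n <oo) diam_pow s (U n))%E |
    U in [set U : nat -> set 'rV[R]_d |
            (forall n, (diam (U n) <= delta%:E)%E) /\
            E `<=` \bigcup_n U n]].

(* The premeasure is nonincreasing in delta, so its limit as delta -> 0+ is a
   supremum. *)
Definition hausdorff_measure (R : realType) (d : nat) (s : R)
    (E : set 'rV[R]_d) : \bar R :=
  ereal_sup [set hausdorff_premeasure s delta E | delta in [set t : R | 0 < t]].

Definition hausdorff_dim (R : realType) (d : nat) (E : set 'rV[R]_d) : \bar R :=
  ereal_inf [set s%:E | s in [set s : R | 0 <= s /\ hausdorff_measure s E = 0%E]].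

(* +oo when E is not covered by finitely many such balls. *)
Definition covering_number (R : realType) (d : nat) (delta : R)
    (E : set 'rV[R]_d) : \bar R :=
  ereal_inf [set (n%:R)%:E | n in [set n : nat |
    exists c : 'I_n -> 'rV[R]_d,
      E `<=` \bigcup_(i in [set: 'I_n]) eucl_closed_ball (c i) (delta / 2)]].

Definition box_ratio (R : realType) (d : nat) (E : set 'rV[R]_d) (delta : R) :
    \bar R :=
  (lne (covering_number delta E) * ((- ln delta)^-1)%:E)%E.

Definition lower_box_dim (R : realType) (d : nat) (E : set 'rV[R]_d) : \bar R :=
  limf_einf (box_ratio E) (0 : R)^'+.

Definition upper_box_dim (R : realType) (d : nat) (E : set 'rV[R]_d) : \bar R :=
  limf_esup (box_ratio E) (0 : R)^'+.

Definition has_box_dim (R : realType) (d : nat) (E : set 'rV[R]_d)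
    (t : \bar R) : Prop :=
  lower_box_dim E = t /\ upper_box_dim E = t.

Definition same_box_dim (R : realType) (d : nat) (E F : set 'rV[R]_d) : Prop :=
  exists t : \bar R, has_box_dim E t /\ has_box_dim F t.

Definition is_subfield (R : realType) (S : set R) : Prop :=
  GRing.divring_closed [in S].

(* Main.v *)
(** With u = s / d, let A be the set of reals in [0, 1] whose binary digits are
    grouped in blocks of slowly growing length L_k = k + K, the last u L_k
    digits of each block being free and the others zero, and let E = A^d.  Up
    to scale, the digits of a block form an arithmetic progression, so for
    xi = p/q replacing A by A + xi A multiplies the number of choices in a block
    by at most q + 2|p|.  There are only about sqrt(n) blocks among the first n
    digits, so rational xi do not change the box dimension.  At suitable scales
    the same count applies to any xi having extremely good rational
    approximations, which gives lower box dimension (hence Hausdorff dimension)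
    s for E + xi E.  By Baire's theorem sqrt 2 is a sum of two such numbers.  On
    the other hand sqrt 2 is badly approximable, so the values a + b sqrt 2
    with a and b in one block are well separated and spill into the forced
    zeros of the block; this yields more than s dimensions for E + sqrt 2 E by
    a mass distribution argument. *)

Require Import Defs.
From HB Require Import structures.
From mathcomp Require Import all_boot all_order all_algebra.
From mathcomp Require Import all_classical all_reals all_analysis.
From mathcomp Require Import ring lra zify.

Set Implicit Arguments.
Unset Strict Implicit.
Unset Printing Implicit Defensive.

Import Order.TTheory GRing.Theory Num.Theory.
Import numFieldNormedType.Exports.

Local Open Scope classical_set_scope.
Local Open Scope ring_scope.

(** * Dimensions of subsets of R^d *)

Lemma normr_coord_le_eucl_dist (R : realType) (d : nat) (x y : 'rV[R]_d)
  (i : 'I_d) : `|x 0 i - y 0 i| <= eucl_dist x y.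
Proof.
rewrite -sqrtr_sqr ler_wsqrtr// (bigD1 i)//= lerDl.
by apply: sumr_ge0 => j _; exact: sqr_ge0.
Qed.

(** The crude factor [d], in place of its square root, is harmless: constant factors do not affect
    dimensions. *)
Lemma eucl_dist_le (R : realType) (d : nat) (x y : 'rV[R]_d) (M : R) :
  0 <= M -> (forall i, `|x 0 i - y 0 i| <= M) -> eucl_dist x y <= d%:R * M.
Proof.
move=> M0 xyM.
have dM0 : 0 <= d%:R * M by rewrite mulr_ge0.
rewrite -(ger0_norm dM0) -sqrtr_sqr ler_wsqrtr//.
apply: (@le_trans _ _ (\sum_(i < d) M ^+ 2)).
  by apply: ler_sum => i _; rewrite -[leLHS]real_normK ?num_real// ler_pXn2r// nnegrE.
rewrite sumr_const card_ord -[leLHS]mulr_natl exprMn ler_wpM2r ?sqr_ge0//.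
by rewrite -natrX ler_nat; case: (d) => // n; rewrite leq_pmulr.
Qed.

Lemma eucl_dist_ge0 (R : realType) (d : nat) (x y : 'rV[R]_d) :
  0 <= eucl_dist x y.
Proof. exact: sqrtr_ge0. Qed.

Lemma diam_ge0 (R : realType) (d : nat) (U : set 'rV[R]_d) : (0 <= diam U)%E.
Proof. by apply: ereal_sup_ubound; left. Qed.

Lemma diam_set0 (R : realType) (d : nat) : diam (set0 : set 'rV[R]_d) = 0%E.
Proof.
apply/eqP; rewrite eq_le diam_ge0 andbT.
by apply: ge_ereal_sup => z [-> //|[x []]].
Qed.

Lemma eucl_dist_le_diam (R : realType) (d : nat) (U : set 'rV[R]_d)
  (x y : 'rV[R]_d) : U x -> U y -> ((eucl_dist x y)%:E <= diam U)%E.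
Proof. by move=> Ux Uy; apply: ereal_sup_ubound; right; exists x => //; exists y. Qed.

Lemma diam_eucl_closed_ball (R : realType) (d : nat) (c : 'rV[R]_d) (r : R) :
  0 <= r -> (diam (eucl_closed_ball c r) <= (d%:R * (2 * r))%:E)%E.
Proof.
move=> r0; apply: ge_ereal_sup => z [->|]; first by rewrite lee_fin mulr_ge0// mulr_ge0.
move=> [x cx [y cy <-]]; rewrite lee_fin; apply: eucl_dist_le; first by rewrite mulr_ge0.
move=> i; have := le_trans (normr_coord_le_eucl_dist c x i) cx.
have := le_trans (normr_coord_le_eucl_dist c y i) cy.
by rewrite !ler_norml; lra.
Qed.

Lemma diam_pow_ge0 (R : realType) (d : nat) (s : R) (U : set 'rV[R]_d) :
  (0 <= diam_pow s U)%E.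
Proof. by rewrite /diam_pow; case: ifP => // _; exact: poweR_ge0. Qed.

Lemma diam_pow_le (R : realType) (d : nat) (s r : R) (U : set 'rV[R]_d) :
  0 <= s -> 0 <= r -> (diam U <= r%:E)%E -> (diam_pow s U <= (r `^ s)%:E)%E.
Proof.
move=> s0 r0 Ur; rewrite /diam_pow; case: ifP => _.
  by rewrite lee_fin powR_ge0.
rewrite -poweR_EFin; apply: gt0_ler_poweR => //; rewrite in_itv/= leey andbT//.
exact: diam_ge0.
Qed.

Lemma hausdorff_premeasure_ge0 (R : realType) (d : nat) (s delta : R)
  (E : set 'rV[R]_d) : (0 <= hausdorff_premeasure s delta E)%E.
Proof.
apply: le_ereal_inf_tmp => _ [U _ <-].
by apply: nneseries_ge0 => n _ _; exact: diam_pow_ge0.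
Qed.

Lemma hausdorff_measure_ge0 (R : realType) (d : nat) (s : R)
  (E : set 'rV[R]_d) : (0 <= hausdorff_measure s E)%E.
Proof.
apply: le_trans (hausdorff_premeasure_ge0 s 1 E) _.
by apply: ereal_sup_ubound; exists 1 => //=.
Qed.

Lemma le_hausdorff_measure (R : realType) (d : nat) (s : R)
  (E F : set 'rV[R]_d) : E `<=` F ->
  (hausdorff_measure s E <= hausdorff_measure s F)%E.
Proof.
move=> EF; apply: ge_ereal_sup => _ [delta /= delta0 <-].
apply: le_ereal_sup_tmp; exists (hausdorff_premeasure s delta F); first by exists delta.
apply: ereal_inf_le_tmp => _ [U [Ud FU] <-]; exists U => //; split => //.
exact: subset_trans FU.
Qed.

Lemma le_hausdorff_dim (R : realType) (d : nat) (E F : set 'rV[R]_d) :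
  E `<=` F -> (hausdorff_dim E <= hausdorff_dim F)%E.
Proof.
move=> EF; apply: ereal_inf_le_tmp => _ [s [s0 Fs] <-]; exists s => //; split => //.
apply/eqP; rewrite eq_le hausdorff_measure_ge0 andbT -Fs.
exact: le_hausdorff_measure.
Qed.

Lemma hausdorff_premeasure_le_finite_cover (R : realType) (d : nat) (s delta r : R)
  (n : nat) (c : 'I_n -> 'rV[R]_d) (F : set 'rV[R]_d) :
  0 <= s -> 0 < delta -> 0 <= r -> d%:R * r <= delta ->
  F `<=` \bigcup_(i in [set: 'I_n]) eucl_closed_ball (c i) (r / 2) ->
  (hausdorff_premeasure s delta F <= (n%:R * (d%:R * r) `^ s)%:E)%E.
Proof.
move=> s0 delta0 r0 rdelta Fc.
pose U k := if insub k is Some i then eucl_closed_ball (c i) (r / 2) else set0.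
have Ur k : (diam (U k) <= (d%:R * r)%:E)%E.
  rewrite /U; case: insubP => [i _ _|_]; last by rewrite diam_set0 lee_fin mulr_ge0.
  apply: le_trans (diam_eucl_closed_ball _ _) _; first by rewrite divr_ge0.
  by rewrite lee_fin ler_wpM2l// mulrC divfK.
apply: (@le_trans _ _ (\sum_(0 <= k <oo) diam_pow s (U k))%E).
  apply: ereal_inf_lbound; exists U => //; split.
    by move=> k; apply: le_trans (Ur k) _; rewrite lee_fin.
  by move=> x /Fc[i _ xi]; exists (val i) => //; rewrite /U valK.
rewrite (nneseries_split 0%N n); last by move=> k _; exact: diam_pow_ge0.
rewrite add0n [X in (_ + X)%E]eseries0 ?adde0; last first.
  move=> k nk _; rewrite /U insubF ?ltnNge ?nk//.
  by rewrite /diam_pow eqxx.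
apply: (@le_trans _ _ (\sum_(0 <= k < n) ((d%:R * r) `^ s)%:E)%E).
  by apply: lee_sum => k _; apply: diam_pow_le => //; rewrite mulr_ge0.
by rewrite sumEFin sumr_const_nat subn0 (mulr_natl (_ `^ _) n).
Qed.

Lemma lower_box_dim_lt (R : realType) (d : nat) (F : set 'rV[R]_d) (t e : R) :
  (lower_box_dim F < t%:E)%E -> 0 < e ->
  exists r : R, [/\ 0 < r, r < e & exists n : nat, n%:R < r `^ (- t) /\
    exists c : 'I_n -> 'rV[R]_d,
      F `<=` \bigcup_(i in [set: 'I_n]) eucl_closed_ball (c i) (r / 2)].
Proof.
rewrite /lower_box_dim limf_einfE => Ft e0.
(* The bound 1 makes [- ln r] positive, so that the denominator of the ratio can be cleared. *)
pose V := [set r : R | 0 < r < Num.min e 1].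
have VF : nbhs (0 : R)^'+ V.
  rewrite /V; near=> r; apply/andP; split; first by near: r; exact: nbhs_right_gt.
  by near: r; apply: nbhs_right_lt; rewrite lt_min e0 ltr01.
have /ereal_inf_lt[_ [r Vr <-]] : (ereal_inf (box_ratio F @` V) < t%:E)%E.
  by apply: le_lt_trans Ft; apply: ereal_sup_ubound; exists V.
move: Vr => /andP[r0]; rewrite lt_min => /andP[re r1] Frt; exists r; split=> //.
have lnr0 : 0 < - ln r by rewrite oppr_gt0 ln_lt0// r0.
suff : (covering_number r F < (r `^ (- t))%:E)%E.
  by move=> /ereal_inf_lt[_ [n [c Fc] <-]]; rewrite lte_fin => nr; exists n; split => //; exists c.
move: Frt; rewrite /box_ratio lte_pdivrMr//.
case: (covering_number r F) => [x||]/=; last by move=> _; rewrite ltNyr.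
  (* The logarithm of a nonpositive real is [-oo]; that case is settled by the positivity of the
     power. *)
  case: ifPn => [x0 _|]; first by rewrite lte_fin (le_lt_trans x0)// powR_gt0.
  rewrite -ltNge => x0; rewrite !lte_fin => H.
  by rewrite -ltr_ln ?posrE ?powR_gt0// ln_powR; lra.
by rewrite -EFinM ltNge leey.
Unshelve. all: by end_near. Qed.

Lemma powR_small (R : realType) (a C eta : R) : 0 < a -> 0 < C -> 0 < eta ->
  exists e : R, 0 < e /\ forall r : R, 0 < r -> r < e -> C * r `^ a <= eta.
Proof.
move=> a0 C0 eta0; exists ((eta / C) `^ a^-1).
have etaC : 0 < eta / C by rewrite divr_gt0.
split; first by rewrite powR_gt0.
move=> r r0 re; rewrite mulrC -ler_pdivlMr//.
rewrite -[leRHS](powRr1 (ltW etaC)) -(mulVf (lt0r_neq0 a0)) powRrM.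
by apply: ge0_ler_powR => //; rewrite ?nnegrE ?powR_ge0// ltW.
Qed.

(** Fewer than [r ^ -(t + e/2)] balls of diameter [r] have a [(t + e)]-sum of order [r ^ (e/2)], and
    [r] can be taken arbitrarily small. *)
Lemma hausdorff_dim_le_lower_box_dim (R : realType) (d : nat)
  (F : set 'rV[R]_d) (t : R) : 0 <= t ->
  (lower_box_dim F <= t%:E)%E -> (hausdorff_dim F <= t%:E)%E.
Proof.
move=> t0 Ft; apply/lee_addgt0Pr => e e0.
rewrite -EFinD; apply: ereal_inf_lbound; exists (t + e) => //.
split; first by rewrite addr_ge0// ltW.
apply/eqP; rewrite eq_le hausdorff_measure_ge0 andbT.
apply: ge_ereal_sup => _ [delta /= delta0 <-].
apply/lee_addgt0Pr => eta eta0; rewrite add0e.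
have te0 : 0 <= t + e by rewrite addr_ge0// ltW.
(* [d + 1] keeps the constant positive even for [d = 0]. *)
have d10 : 0 < (d%:R + 1 : R) by rewrite ltr_wpDl.
have [|e1 [e10 small]] := powR_small _ (powR_gt0 (t + e) d10) eta0 (a := e / 2).
  by rewrite divr_gt0.
have : (lower_box_dim F < (t + e / 2)%:E)%E.
  by apply: le_lt_trans Ft _; rewrite lte_fin ltrDl divr_gt0.
move=> /lower_box_dim_lt -/(_ (Num.min e1 (delta / (d%:R + 1))))[].
  by rewrite lt_min e10 divr_gt0.
move=> r [r0]; rewrite lt_min => /andP[re1 rdelta] [n [nr [c Fc]]].
apply: le_trans (hausdorff_premeasure_le_finite_cover te0 delta0 (ltW r0) _ Fc) _.
  move: rdelta; rewrite ltr_pdivlMr// => rdelta; apply: ltW; apply: le_lt_trans rdelta.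
  by rewrite mulrC ler_wpM2l ?(ltW r0)// lerDl.
rewrite lee_fin; apply: le_trans (small r r0 re1).
have -> : r `^ (e / 2) = r `^ (- (t + e / 2)) * r `^ (t + e).
  rewrite -powRD; first by congr (_ `^ _); lra.
  by rewrite (gt_eqF r0) implybT.
rewrite mulrCA -powRM ?(ltW r0)// ?(ltW d10)//.
apply: ler_pM => //; rewrite ?powR_ge0//; first exact: ltW nr.
apply: ge0_ler_powR; rewrite ?nnegrE ?mulr_ge0 ?(ltW r0)//.
by rewrite ler_wpM2r ?(ltW r0)// lerDl.
Qed.

Lemma lower_box_dim_ge (R : realType) (d : nat) (F : set 'rV[R]_d) (s : R) :
  0 < s -> (s%:E <= hausdorff_dim F)%E -> (s%:E <= lower_box_dim F)%E.
Proof.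
move=> s0 sF; rewrite leNgt; apply/negP => Fs.
have [t /andP[t0 ts] Ft] : exists2 t, 0 <= t < s & (lower_box_dim F <= t%:E)%E.
  move: Fs; case: (lower_box_dim F) => [x||]//.
    rewrite lte_fin => xs; exists (Num.max 0 x); rewrite ?lee_fin ?le_max ?lexx ?orbT//.
    by rewrite gt_max s0 xs.
  by exists 0; rewrite ?lexx ?s0// leNye.
have := le_trans sF (hausdorff_dim_le_lower_box_dim t0 Ft).
by rewrite lee_fin leNgt ts.
Qed.

Lemma lower_le_upper_box_dim (R : realType) (d : nat) (F : set 'rV[R]_d) :
  (lower_box_dim F <= upper_box_dim F)%E.
Proof.
rewrite /lower_box_dim limf_einfE; apply: ge_ereal_sup => _ [V VF <-].
apply: le_ereal_inf_tmp => _ [W WF <-].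
have [x [Vx Wx]] := filter_ex (filterI VF WF).
apply: (@le_trans _ _ (box_ratio F x)).
  by apply: ereal_inf_lbound; exists x.
by apply: ereal_sup_ubound; exists x.
Qed.

Lemma le_card_cover (I : finType) (N : nat) (A : nat -> pred I) :
  (forall i, exists2 n, (n < N)%N & A n i) -> (#|I| <= \sum_(n < N) #|A n|)%N.
Proof.
move=> IA; under eq_bigr do rewrite -sum1_card big_mkcond.
rewrite exchange_big/= -sum1_card; apply: leq_sum => i _.
have [n nN Ani] := IA i.
by rewrite (bigD1 (Ordinal nN))//= unfold_in Ani.
Qed.

(* A finitary mass distribution principle: compactness reduces a cover to
   finitely many sets, hence only finitely many scales matter and a normalized
   counting measure at a finer scale can be used instead of a limit measure. *)
Lemma mass_distribution (R : realType) (d : nat) (F : set 'rV[R]_d) (t C : R) :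
  compact F -> 0 < t -> 0 < C ->
  (forall r : R, 0 < r -> exists (I : finType) (p : I -> 'rV[R]_d),
    [/\ (0 < #|I|)%N, forall i, F (p i) & forall (x : 'rV[R]_d) (rho : R), r <= rho ->
      #|[pred i | [forall j, `|p i 0 j - x 0 j| <= rho]]|%:R
        <= C * rho `^ t * #|I|%:R]) ->
  (t%:E <= hausdorff_dim F)%E.
Proof.
move=> Fc t0 C0 Fspread; apply: le_ereal_inf_tmp => _ [s [s0 Fs] <-].
rewrite lee_fin leNgt; apply/negP => st.
(* The enlarged cover will have total weight at most [2 * eps], so that [C] times it is 1/2, less
   than the full mass. *)
pose eps := (4 * C)^-1.
have eps0 : 0 < eps by rewrite invr_gt0 mulr_gt0.
have : (hausdorff_premeasure s 1 F < eps%:E)%E.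
  apply: (@le_lt_trans _ _ 0%E); last by rewrite lte_fin.
  by rewrite -Fs; apply: ereal_sup_ubound; exists 1 => //=.
move=> /ereal_inf_lt[_ [U [U1 FU] <-]] Usum.
pose w n := fine (diam_pow s (U n)).
have wE n : diam_pow s (U n) = (w n)%:E.
  rewrite /w fineK// ge0_fin_numE ?diam_pow_ge0//.
  by rewrite (le_lt_trans (diam_pow_le s0 ler01 (U1 n)))// ltry.
have w0 n : 0 <= w n by rewrite -lee_fin -wE diam_pow_ge0.
(* Summable slack of total [eps]: it turns each set, even a single point, into an open ball of
   positive radius, as compactness requires. *)
pose e n := eps / (2 ^ n.+1)%:R.
have e0 n : 0 < e n by rewrite divr_gt0// ltr0n expn_gt0.
have sumwe N : \sum_(n < N) (w n + e n) <= 2 * eps.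
  rewrite -(big_mkord xpredT (fun n => w n + e n)) -lee_fin -sumEFin.
  apply: (@le_trans _ _ (\sum_(0 <= n <oo) (diam_pow s (U n) + (e n)%:E))%E).
    under eq_bigr do rewrite EFinD -wE.
    apply: nneseries_lim_ge => n _ _.
    by rewrite adde_ge0 ?diam_pow_ge0// lee_fin ltW.
  apply: le_trans (epsilon_trick xpredT (fun n => diam_pow_ge0 s (U n)) (ltW eps0)) _.
  apply: (@le_trans _ _ (eps%:E + eps%:E)%E); first by apply: leeD => //; exact: ltW.
  by rewrite -EFinD lee_fin; lra.
pose rho n := (w n + e n) `^ t^-1.
have we0 n : 0 < w n + e n by rewrite ltr_wpDl.
have rho0 n : 0 < rho n by rewrite powR_gt0.
have rhot n : rho n `^ t = w n + e n.
  by rewrite -powRrM mulVf ?gt_eqF// powRr1// ltW.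
(* A distance [D] inside [U n] is at most 1 and [s < t], so [D ^ t <= D ^ s <= w n < rho n ^ t]. *)
have exc n : exists c, U n `<=` ball (c : 'rV[R]_d) (rho n).
  have [->|/set0P[c Uc]] := eqVneq (U n) set0; first by exists 0.
  exists c => y Uy; split => // i j; rewrite (ord1 i) /ball/= .
  apply: le_lt_trans (normr_coord_le_eucl_dist c y j) _.
  set D := eucl_dist c y.
  have D0 : 0 <= D by exact: eucl_dist_ge0.
  have DU : (D%:E <= diam (U n))%E by exact: eucl_dist_le_diam.
  have D1 : D <= 1 by rewrite -lee_fin (le_trans DU).
  have Dw : D `^ s <= w n.
    rewrite -lee_fin -wE /diam_pow ifF; last by apply/eqP => U0; move: Uc; rewrite U0.
    rewrite -poweR_EFin; apply: gt0_ler_poweR => //; rewrite in_itv/= leey andbT//.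
    exact: diam_ge0.
  have [->|DN0] := eqVneq D 0; first exact: rho0.
  have {DN0}D0 : 0 < D by rewrite lt_neqAle eq_sym DN0.
  rewrite -(powRr1 (ltW D0)) -(mulfV (lt0r_neq0 t0)) powRrM.
  apply: gt0_ltr_powR; rewrite ?invr_gt0 ?nnegrE ?powR_ge0 ?(ltW (we0 _))//.
  apply: (@le_lt_trans _ _ (w n)); last by rewrite ltrDl.
  by apply: le_trans Dw; apply: ger_powR; rewrite ?D0// ltW.
have [c Uc] := choice exc.
have : exists N, forall x, F x -> exists2 n, (n < N)%N & ball (c n) (rho n) x.
  move: Fc; rewrite compact_cover => /(_ nat setT (fun n => ball (c n) (rho n))).
  case=> [n _||D _ FD]; first exact: ball_open.
    by move=> x /FU[n _ /Uc ?]; exists n.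
  exists (\max_(i <- finmap.enum_fset D) i).+1 => x /FD[n /= nD xn]; exists n => //.
  by rewrite ltnS; apply: leq_bigmax_seq.
move=> [N FN].
(* Only finitely many radii remain; below all of them the test points can be requested. *)
have [r r0 rrho] : exists2 r, 0 < r & forall n, (n < N)%N -> r <= rho n.
  exists (\big[Num.min/1]_(n < N) rho n).
    by apply/bigmin_gtP; split=> // n _; exact: rho0.
  by move=> n nN; exact: (bigmin_le _ (Ordinal nN) (fun n : 'I_N => rho n)).
have [I [p [I0 Fp pcount]]] := Fspread r r0.
have : #|I|%:R <= \sum_(n < N) (C : R) * rho n `^ t * #|I|%:R.
  have /(le_card_cover) IN : forall i, exists2 n, (n < N)%N &
      [pred i | [forall j, `|p i 0 j - c n 0 j| <= rho n]] i.
    move=> i; have [n nN [_ pi]] := FN _ (Fp i); exists n => //=.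
    apply/forallP => j; have := pi 0 j; rewrite /ball/= => /ltW.
    by rewrite distrC.
  apply: (@le_trans _ _ (\sum_(n < N) #|[pred i | [forall j, `|p i 0 j - c n 0 j| <= rho n]%R]|)%N%:R).
    by rewrite ler_nat.
  by rewrite natr_sum; apply: ler_sum => n _; apply: pcount; exact: rrho.
apply/negP; rewrite -ltNge -mulr_suml gtr_pMl ?ltr0n// -mulr_sumr.
apply: (@le_lt_trans _ _ (C * (2 * eps))); last first.
  by rewrite /eps invfM mulrCA (mulrCA C) mulfV ?gt_eqF//; lra.
rewrite ler_wpM2l ?(ltW C0)//; apply: le_trans (sumwe N).
by apply: ler_sum => n _; rewrite rhot.
Qed.

(** * Cubes over subsets of R *)

Definition cube (R : realType) (d : nat) (A : set R) : set 'rV[R]_d :=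
  [set v | forall i, A (v 0 i)].
Arguments cube {R} d A.

Lemma compact_cube (R : realType) (d : nat) (A : set R) :
  compact A -> compact (cube d A).
Proof. by move=> Ac; apply: (@rV_compact _ d (fun=> A)). Qed.

Lemma le_cube (R : realType) (d : nat) (A B : set R) :
  A `<=` B -> cube d A `<=` cube d B.
Proof. by move=> AB v Av i; apply/AB/Av. Qed.

Definition lin_sum (R : realType) (A : set R) (xi : R) : set R :=
  [set x + xi * y | x in A & y in A].

(** Coordinates are chosen independently, which reduces all questions to subsets of the line. *)
Lemma set_sum_cube (R : realType) (d : nat) (A : set R) (xi : R) :
  set_sum (cube d A) (set_scale xi (cube d A)) = cube d (lin_sum A xi).
Proof.
apply/seteqP; split=> [_ [x Ax [_ [y Ay <-] <-]] i|v Av].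
  by rewrite !mxE; exists (x 0 i) => //; exists (y 0 i).
have /choice[g gP] : forall i, exists xy : R * R,
    [/\ A xy.1, A xy.2 & xy.1 + xi * xy.2 = v 0 i].
  by move=> i; have [x Ax [y Ay xyE]] := Av i; exists (x, y).
exists (\row_i (g i).1); first by move=> i; rewrite mxE; have [] := gP i.
exists (xi *: \row_i (g i).2).
  by exists (\row_i (g i).2) => // i; rewrite mxE; have [] := gP i.
by apply/rowP => i; rewrite !mxE; have [] := gP i.
Qed.

(** One-dimensional form of the hypothesis of [mass_distribution]. The test points form a sequence,
    so that repetitions count as mass. *)
Definition spread (R : realType) (A : set R) (t : R) : Prop :=
  exists2 C : R, 0 < C & forall r : R, 0 < r -> exists P : seq R,
    [/\ (0 < size P)%N, {in P, forall p, A p} &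
        forall x rho : R, r <= rho ->
          (count (fun p => `|p - x| <= rho) P)%:R <= C * rho `^ t * (size P)%:R].

(** The test points in the cube are all [d]-tuples of test points on the line. A sup-norm ball is a
    product of intervals, so its count is the product of the counts. *)
Lemma spread_hausdorff_dim (R : realType) (d : nat) (A : set R) (t : R) :
  (1 <= d)%N -> compact A -> 0 < t -> spread A t ->
  ((d%:R * t)%:E <= hausdorff_dim (cube d A))%E.
Proof.
move=> d1 Ac t0 [C C0 spreadA].
have d0 : 0 < (d%:R : R) by rewrite ltr0n.
apply: (@mass_distribution _ _ _ _ (C ^+ d)); first exact: compact_cube.
- by rewrite mulr_gt0.
- by rewrite exprn_gt0.
move=> r r0; have [P [P0 PA Pcount]] := spreadA r r0.
pose N := size P.
exists {ffun 'I_d -> 'I_N}, (fun f : {ffun 'I_d -> 'I_N} => \row_i nth 0 P (f i)); split.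
- by rewrite card_ffun !card_ord expn_gt0 P0.
- by move=> f i; rewrite mxE; apply: PA; rewrite mem_nth.
move=> x rho rrho; have rho0 : 0 < rho by exact: lt_le_trans rrho.
pose Q j : pred 'I_N := [pred k : 'I_N | `|nth 0 P k - x 0 j| <= rho].
have cQ j : #|Q j| = count (fun p => `|p - x 0 j| <= rho) P.
  by rewrite -sum1_card -sum1_count (big_nth 0) big_mkord.
rewrite (_ : #|_| = #|family Q|); last first.
  apply: eq_card => f; rewrite !inE; apply: eq_forallb => j.
  by rewrite mxE.
rewrite card_family foldrE big_map big_enum/=.
rewrite card_ffun !card_ord natrX natr_prod mulrC.
have -> : rho `^ (d%:R * t) = (rho `^ t) ^+ d.
  by rewrite mulrC powRrM powR_mulrn// powR_ge0.
rewrite mulrC -!exprMn (_ : _ ^+ d = \prod_(j < d) (C * rho `^ t * N%:R)); last first.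
  by rewrite prodr_const card_ord.
apply: ler_prod => j _; rewrite ler0n/= cQ; exact: Pcount.
Qed.

(** * Upper bounds for box dimensions of cubes *)

Definition coverable (R : realType) (A : set R) (rho N : R) : Prop :=
  exists P : seq R, (size P)%:R <= N /\
    forall x, A x -> exists2 p, p \in P & `|x - p| <= rho.

Lemma covering_number_ge0 (R : realType) (d : nat) (delta : R)
  (E : set 'rV[R]_d) : (0 <= covering_number delta E)%E.
Proof. by apply: le_ereal_inf_tmp => _ [n _ <-]; rewrite lee_fin. Qed.

(** The grid of centres works: a cube of half-side [rho] lies in a Euclidean ball of radius
    [d * rho], that is of diameter [2 * d * rho]. *)
Lemma covering_number_cube (R : realType) (d : nat) (A : set R) (rho N : R) :
  0 <= rho -> coverable A rho N ->
  (covering_number (2 * d%:R * rho) (cube d A) <= (N ^+ d)%:E)%E.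
Proof.
move=> rho0 [P [PN Pcover]]; set n := size P in PN.
apply: ge_ereal_inf; exists (n ^ d)%:R%:E; last first.
  by rewrite lee_fin natrX; apply: lerXn2r; rewrite ?nnegrE// (le_trans _ PN).
rewrite -[X in (X ^ _)%N]card_ord -[X in (_ ^ X)%N]card_ord -card_ffun.
exists #|{ffun 'I_d -> 'I_n}| => //=.
exists (fun k => \row_j nth 0 P ((enum_val k : {ffun 'I_d -> 'I_n}) j)).
move=> v Av; have /choice[f fP] : forall j, exists k : 'I_n, `|v 0 j - nth 0 P k| <= rho.
  move=> j; have [p pP vp] := Pcover _ (Av j).
  have pn : (index p P < n)%N by rewrite index_mem.
  by exists (Ordinal pn); rewrite /= nth_index.
exists (enum_rank [ffun j => f j]) => //.
rewrite /eucl_closed_ball/= enum_rankK.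
rewrite (_ : 2 * d%:R * rho / 2 = d%:R * rho); last by field.
apply: eucl_dist_le => // j.
by rewrite mxE ffunE distrC.
Qed.

Lemma box_ratio_le (R : realType) (d : nat) (F : set 'rV[R]_d) (delta v : R) :
  0 < delta < 1 -> (covering_number delta F <= (delta `^ (- v))%:E)%E ->
  (box_ratio F delta <= v%:E)%E.
Proof.
move=> /andP[delta0 delta1] Fv.
have lnd0 : 0 < - ln delta by rewrite oppr_gt0 ln_lt0// delta0.
have dv0 : 0 < delta `^ (- v) by rewrite powR_gt0.
rewrite /box_ratio lee_pdivrMr//.
rewrite (_ : (v%:E * _)%E = lne (delta `^ (- v))%:E); last first.
  by rewrite lne_EFin// ln_powR -EFinM; congr EFin; ring.
by rewrite lee_lne// in_itv/= leey andbT ?covering_number_ge0// lee_fin ltW.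
Qed.

(** The gain [rho ^ (v' - v)] absorbs the factor [2 * d] between the two scales once [rho] is
    small. *)
Lemma box_ratio_cube (R : realType) (d : nat) (A : set R) (v v' : R) :
  (1 <= d)%N -> 0 <= v -> v < v' ->
  exists2 e : R, 0 < e & forall rho : R, 0 < rho -> rho < e ->
    coverable A rho (rho `^ (- v)) ->
    (box_ratio (cube d A) (2 * d%:R * rho) <= (d%:R * v')%:E)%E.
Proof.
move=> d1 v0 vv'.
have dp : 0 < (d%:R : R) by rewrite ltr0n.
have d0 : 0 < (2 * d%:R : R) by rewrite mulr_gt0.
have vv'0 : 0 < v' - v by rewrite subr_gt0.
have [e [e0 small]] := powR_small vv'0 (powR_gt0 v' d0) ltr01.
exists (Num.min e (2 * d%:R)^-1); first by rewrite lt_min e0 invr_gt0.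
move=> rho rho0; rewrite lt_min => /andP[rhoe rhod] Acov.
apply: box_ratio_le.
  by rewrite mulr_gt0//= mulrC -ltr_pdivlMr// div1r.
apply: le_trans (covering_number_cube _ (ltW rho0) Acov) _.
rewrite lee_fin.
have -> : (2 * d%:R * rho) `^ (- (d%:R * v')) = ((2 * d%:R * rho) `^ (- v')) ^+ d.
  by rewrite (mulrC d%:R) -mulNr powRrM powR_mulrn// powR_ge0.
apply: lerXn2r; rewrite ?nnegrE ?powR_ge0//.
rewrite !powRN lef_pV2 ?posrE ?powR_gt0 ?mulr_gt0//.
rewrite powRM ?(ltW d0) ?(ltW rho0)//.
have -> : rho `^ v' = rho `^ (v' - v) * rho `^ v.
  rewrite -powRD ?(gt_eqF rho0) ?implybT//.
  by rewrite subrK.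
by rewrite mulrA ler_piMl ?powR_ge0 ?small//.
Qed.

Lemma upper_box_dim_cube (R : realType) (d : nat) (A : set R) (u : R) :
  (1 <= d)%N -> 0 <= u ->
  (forall e : R, 0 < e -> exists2 r : R, 0 < r & forall rho : R, 0 < rho -> rho < r ->
     coverable A rho (rho `^ (- (u + e)))) ->
  (upper_box_dim (cube d A) <= (d%:R * u)%:E)%E.
Proof.
move=> d1 u0 Acov; apply/lee_addgt0Pr => e e0; rewrite -EFinD.
have dp : 0 < (d%:R : R) by rewrite ltr0n.
have d20 : 0 < (2 * d%:R : R) by rewrite mulr_gt0.
(* Half of the slack [e / d] per coordinate goes to the coverings, the other half to the change of
   scale in [box_ratio_cube]. *)
have ed0 : 0 < e / d%:R / 2 by rewrite !divr_gt0.
have ued0 : 0 <= u + e / d%:R / 2 by rewrite addr_ge0// ltW.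
have [r r0 rcov] := Acov _ ed0.
have [r' r'0 r'box] := box_ratio_cube A d1 ued0
  (ltac:(lra) : u + e / d%:R / 2 < u + e / d%:R).
apply: ge_ereal_inf; eexists; last first.
  apply: (_ : (ereal_sup (box_ratio (cube d A) @`
    [set x | (0 < x < 2 * d%:R * Num.min r r')%R]) <= _)%E).
  apply: ge_ereal_sup => _ [x /= /andP[x0 xr] <-].
  rewrite -[x](mulVKf (lt0r_neq0 d20)).
  have {}xr : (2 * d%:R)^-1 * x < Num.min r r' by rewrite mulrC ltr_pdivrMr// mulrC.
  have {}x0 : 0 < (2 * d%:R)^-1 * x by rewrite mulr_gt0// invr_gt0.
  move: xr; rewrite lt_min => /andP[xr xr'].
  apply: le_trans (r'box _ x0 xr' (rcov _ x0 xr)) _.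
  by rewrite lee_fin mulrDr mulrC (mulrC _ (e / _)) divfK ?gt_eqF// mulrC.
exists [set x : R | 0 < x < 2 * d%:R * Num.min r r'] => //.
near=> x; apply/andP; split; first by near: x; exact: nbhs_right_gt.
by near: x; apply: nbhs_right_lt; rewrite mulr_gt0// lt_min r0.
Unshelve. all: by end_near. Qed.

Lemma lower_box_dim_cube (R : realType) (d : nat) (A : set R) (u : R) :
  (1 <= d)%N -> 0 <= u ->
  (forall e r : R, 0 < e -> 0 < r -> exists rho : R, [/\ 0 < rho, rho < r &
     coverable A rho (rho `^ (- (u + e)))]) ->
  (lower_box_dim (cube d A) <= (d%:R * u)%:E)%E.
Proof.
move=> d1 u0 Acov; apply/lee_addgt0Pr => e e0; rewrite -EFinD.
have dp : 0 < (d%:R : R) by rewrite ltr0n.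
have d20 : 0 < (2 * d%:R : R) by rewrite mulr_gt0.
have ed0 : 0 < e / d%:R / 2 by rewrite !divr_gt0.
have ued0 : 0 <= u + e / d%:R / 2 by rewrite addr_ge0// ltW.
have [r' r'0 r'box] := box_ratio_cube A d1 ued0
  (ltac:(lra) : u + e / d%:R / 2 < u + e / d%:R).
rewrite /lower_box_dim limf_einfE; apply: ge_ereal_sup => _ [V VF <-].
have [r /= r0 rV] : exists2 r, 0 < r & forall x, 0 < x -> x < r -> V x.
  move: VF; rewrite /at_right /within/= => /nbhs_ballP[r /= r0 rV]; exists r => // x x0 xr.
  by apply: rV => //; rewrite /ball/= sub0r normrN gtr0_norm.
have [|rho [rho0]] := Acov _ (Num.min (r / (2 * d%:R)) r') ed0.
  by rewrite lt_min divr_gt0.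
rewrite lt_min => /andP[]; rewrite ltr_pdivlMr// => rhor rhor' cov.
apply: ge_ereal_inf; exists (box_ratio (cube d A) (2 * d%:R * rho)).
  by exists (2 * d%:R * rho) => //; apply: rV; rewrite ?mulr_gt0// mulrC.
apply: le_trans (r'box _ rho0 rhor' cov) _.
by rewrite lee_fin mulrDr mulrC (mulrC _ (e / _)) divfK ?gt_eqF// mulrC.
Qed.

(** * Sets of digit sums *)

(** The recursion removes the first digit and shifts the digit sets, so inductions on [n] generalize
    over [D] and [T]. Sums are listed with multiplicity. *)
Fixpoint gsum (R : realType) (D : nat -> seq R) (n : nat) : seq R :=
  if n is n'.+1 then [seq x + y | x <- D 0%N, y <- gsum (fun k => D k.+1) n']
  else [:: 0].

(* [T k] bounds every sum of digits of rank at least [k]. *)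
Definition digits (R : realType) (D : nat -> seq R) (T : nat -> R) : Prop :=
  forall k, 0 <= T k /\ forall x, x \in D k -> 0 <= x /\ x + T k.+1 <= T k.

(** When [T] tends to 0 these are the infinite digit sums. Describing them by finite truncations
    avoids series and exhibits an intersection of finite unions of segments, hence a compact set. *)
Definition gset (R : realType) (D : nat -> seq R) (T : nat -> R) : set R :=
  [set x | forall n, exists2 p, p \in gsum D n & p <= x <= p + T n].

Lemma digits_shift (R : realType) (D : nat -> seq R) (T : nat -> R) :
  digits D T -> digits (fun k => D k.+1) (fun k => T k.+1).
Proof. by move=> DT k; exact: DT. Qed.

Lemma size_gsum (R : realType) (D : nat -> seq R) (n : nat) :
  size (gsum D n) = (\prod_(k < n) size (D k))%N.
Proof.
elim: n D => [|n IHn] D /=; first by rewrite big_ord0.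
by rewrite size_allpairs big_ord_recl IHn.
Qed.

Lemma gsum_bound (R : realType) (D : nat -> seq R) (T : nat -> R) (n : nat) (x : R) :
  digits D T -> x \in gsum D n -> 0 <= x <= T 0%N.
Proof.
elim: n D T x => [|n IHn] D T x DT /=.
  by rewrite inE => /eqP ->; rewrite lexx; have [] := DT 0%N.
move=> /allpairsP[[d y] /= [dD yD ->]].
have [_ /(_ _ dD)[d0 dT]] := DT 0%N.
have /andP[y0 yT] := IHn _ _ _ (digits_shift DT) yD.
by rewrite addr_ge0//= (le_trans _ dT)// lerD2l.
Qed.

(** A sum that is too short is padded with zero digits; one that is too long is truncated, and [T m]
    bounds the discarded tail. *)
Lemma gsum_approx (R : realType) (D : nat -> seq R) (T : nat -> R) (n m : nat) (x : R) :
  digits D T -> (forall k, 0 \in D k) -> x \in gsum D n ->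
  exists2 p, p \in gsum D m & p <= x <= p + T m.
Proof.
elim: m n D T x => [|m IHm] n D T x DT D0 xD.
  by exists 0; [rewrite /= inE|rewrite add0r; exact: gsum_bound xD].
case: n xD => [|n] /= xD.
  have zD : 0 \in gsum (fun k => D k.+1) 0 by rewrite /= inE.
  have [p pD /andP[p0 pT]] := IHm 0%N _ _ _ (digits_shift DT) (fun k => D0 k.+1) zD.
  move: xD; rewrite inE => /eqP ->; exists p; last by rewrite p0.
  by apply/allpairsP; exists (0, p); rewrite /= D0 add0r.
move: xD => /allpairsP[[d y] /= [dD yD ->]].
have [p pD /andP[py yp]] := IHm n _ _ _ (digits_shift DT) (fun k => D0 k.+1) yD.
exists (d + p); first by apply/allpairsP; exists (d, p).
by rewrite lerD2l py -addrA lerD2l.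
Qed.

Lemma gsum_sub_gset (R : realType) (D : nat -> seq R) (T : nat -> R) (n : nat) (x : R) :
  digits D T -> (forall k, 0 \in D k) -> x \in gsum D n -> gset D T x.
Proof. by move=> DT D0 xD m; exact: gsum_approx xD. Qed.

Lemma gset_bound (R : realType) (D : nat -> seq R) (T : nat -> R) (x : R) :
  gset D T x -> 0 <= x <= T 0%N.
Proof. by move=> /(_ 0%N)[p]; rewrite /= inE => /eqP ->; rewrite add0r. Qed.

Lemma compact_gset (R : realType) (D : nat -> seq R) (T : nat -> R) :
  compact (gset D T).
Proof.
apply: (@subclosed_compact _ _ `[0, T 0%N]); last 2 first.
- exact: segment_compact.
- by move=> x /gset_bound; rewrite /= in_itv.
have -> : gset D T = \bigcap_n \big[setU/set0]_(p <- gsum D n) `[p, p + T n]%classic.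
  apply/seteqP; split=> x.
    move=> xD n _; have [p pD px] := xD n.
    by rewrite -bigcup_seq; exists p => //=; rewrite in_itv.
  move=> xD n; have := xD n I; rewrite -bigcup_seq => -[p /= pD].
  by rewrite in_itv/=; exists p.
by apply: closed_bigI => n _; apply: closed_bigsetU => p _; exact: itv_closed.
Qed.

Lemma gsum_sub (R : realType) (D D' : nat -> seq R) (n : nat) :
  (forall k, {subset D k <= D' k}) -> {subset gsum D n <= gsum D' n}.
Proof.
elim: n D D' => [|n IHn] D D' DD' x //= /allpairsP[[d y] /= [dD yD ->]].
apply/allpairsP; exists (d, y); split => //=; first exact: DD'.
by apply: IHn yD => k; exact: DD'.
Qed.

Lemma gsum_lin (R : realType) (D D' : nat -> seq R) (xi : R) (n : nat) (p q : R) :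
  (forall k a b, a \in D k -> b \in D k -> a + xi * b \in D' k) ->
  p \in gsum D n -> q \in gsum D n -> p + xi * q \in gsum D' n.
Proof.
elim: n D D' p q => [|n IHn] D D' p q DD' /=.
  by rewrite !inE => /eqP -> /eqP ->; rewrite mulr0 addr0.
move=> /allpairsP[[a x] /= [aD xD ->]] /allpairsP[[b y] /= [bD yD ->]].
apply/allpairsP; exists (a + xi * b, x + xi * y); split => /=.
- exact: DD'.
- by apply: (IHn _ (fun k => D' k.+1)) xD yD => k; exact: DD'.
- by rewrite mulrDr addrACA.
Qed.

Lemma gsum_split (R : realType) (D G : nat -> seq R) (xi : R) (n : nat) (z : R) :
  (forall k g, g \in G k -> exists a b, [/\ a \in D k, b \in D k & g = a + xi * b]) ->
  z \in gsum G n ->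
  exists p q, [/\ p \in gsum D n, q \in gsum D n & z = p + xi * q].
Proof.
elim: n D G z => [|n IHn] D G z GD /=.
  by rewrite inE => /eqP ->; exists 0, 0; rewrite !inE eqxx mulr0 addr0.
move=> /allpairsP[[g x] /= [gG xG ->]].
have [a [b [aD bD ->]]] := GD _ _ gG.
have [p [q [pD qD ->]]] := IHn (fun k => D k.+1) _ _ (fun k => GD k.+1) xG.
exists (a + p), (b + q); split.
- by apply/allpairsP; exists (a, p).
- by apply/allpairsP; exists (b, q).
- by rewrite mulrDr addrACA.
Qed.

Lemma leq_sum_single (R : eqType) (s : seq R) (F : R -> nat) (B : nat) :
  uniq s -> (forall x, x \in s -> (F x <= B)%N) ->
  (forall x y, x \in s -> y \in s -> F x != 0%N -> F y != 0%N -> x = y) ->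
  (\sum_(x <- s) F x <= B)%N.
Proof.
move=> us FB Fone; have [/hasP[x xs Fx]|/hasPn F0] := boolP (has (fun x => F x != 0%N) s).
  rewrite (bigD1_seq x)//= big_seq_cond big1 ?addn0 ?FB// => y /andP[ys yx].
  by apply/eqP; apply: contraNT yx => Fy; rewrite (Fone y x).
by rewrite big_seq big1// => x /F0; rewrite negbK => /eqP.
Qed.

(* A ball of radius small compared with the gaps [sigma j], [j < k], meets only
   sums sharing the same first [k] digits. *)
Lemma count_gsum (R : realType) (D : nat -> seq R) (T sigma : nat -> R) (k n : nat)
  (x rho : R) : digits D T ->
  (forall j, (j < k)%N -> [/\ uniq (D j), 2 * rho + T j.+1 < sigma j &
     forall a b, a \in D j -> b \in D j -> a != b -> sigma j <= `|a - b|]) ->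
  (k <= n)%N ->
  (count (fun p => (`|p - x| <= rho)%R) (gsum D n) * \prod_(j < k) size (D j)
     <= size (gsum D n))%N.
Proof.
elim: k n D T sigma x => [|k IHk] n D T sigma x DT Dsep.
  by rewrite big_ord0 muln1 count_size.
case: n => // n; rewrite ltnS => kn.
have DT' := digits_shift DT.
have [D0u D0rho D0sep] := Dsep 0%N isT.
rewrite [gsum D n.+1]/= size_allpairs big_ord_recl mulnCA leq_mul2l; apply/orP; right.
set G := gsum (fun i => D i.+1) n; set N := (\prod_(i < k) _)%N.
have -> : count (fun p => `|p - x| <= rho) [seq a + b | a <- D 0%N, b <- G]
    = (\sum_(a <- D 0%N) count (fun p => (`|p - (x - a)| <= rho)%R) G)%N.
  rewrite count_flatten sumnE !big_map; apply: eq_bigr => a _.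
  by rewrite count_map; apply: eq_count => b /=; rewrite opprB addrCA addrA.
rewrite big_distrl/=; apply: leq_sum_single => // [a _|a b aD bD].
  apply: (IHk n _ _ (fun j => sigma j.+1)) kn => //; first exact: DT'.
  by move=> j jk; exact: (Dsep j.+1).
(* If two leading digits both contributed, they would differ by at most [2 * rho + T 1], which is
   less than their gap. *)
rewrite !muln_eq0 !negb_or => /andP[/eqP/eqP + _] /andP[/eqP/eqP + _].
rewrite -!lt0n -!has_count => /hasP[p pG pa] /hasP[q qG qb].
apply/eqP; apply: contraPT D0rho => ab; apply/negP; rewrite -leNgt.
apply: le_trans (D0sep _ _ aD bD ab) _.
have /andP[] := gsum_bound DT' pG; have /andP[] := gsum_bound DT' qG.
by move: pa qb; rewrite !ler_norml; lra.
Qed.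

(** * The digit blocks *)

(* [level K k] is the binary place where block [k], of length [k + K], starts. *)
Definition level (K k : nat) : nat := \sum_(j < k) (j + K).

Lemma levelS (K k : nat) : level K k.+1 = (level K k + (k + K))%N.
Proof. by rewrite /level big_ord_recr. Qed.

Lemma level_quadratic (K k : nat) : (k * k <= 2 * level K k + k)%N.
Proof.
elim: k => // k IHk; rewrite levelS; nia.
Qed.

Lemma leq_level (K j k : nat) : (j <= k)%N -> (level K j <= level K k)%N.
Proof.
move=> /subnK <-; elim: (k - j)%N => // n IHn; rewrite addSn levelS.
exact: leq_trans IHn (leq_addr _ _).
Qed.

(** Levels grow quadratically, so every cost linear in the number of blocks becomes negligible
    against them. *)
Lemma level_superlinear (R : realType) (K : nat) (B : R) :
  exists k0 : nat, forall k, (k0 <= k)%N -> B * k.+1%:R <= (level K k)%:R.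
Proof.
pose b := Num.trunc `|B|.
exists (4 * b + 7)%N => k bk.
apply: (@le_trans _ _ (b.+1 * k.+1)%:R); last by rewrite ler_nat; have := level_quadratic K k; nia.
rewrite natrM ler_wpM2r//.
by apply: le_trans (ler_norm _) _; apply: ltW; exact: truncnS_gt.
Qed.

Lemma exp_half_le (R : realType) (m n : nat) :
  (m <= n)%N -> (2^-1 : R) ^+ n <= 2^-1 ^+ m.
Proof. by move=> mn; apply: ler_wiXn2l => //; lra. Qed.

Lemma exp_half_unbounded (R : realType) (r : R) :
  0 < r -> exists n : nat, 2^-1 ^+ n <= r.
Proof.
move=> r0; exists (Num.trunc r^-1).+1.
rewrite -[leRHS]invrK exprVn lef_pV2 ?posrE ?invr_gt0 ?exprn_gt0//.
apply: le_trans (ltW (truncnS_gt _)) _.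
by rewrite -natrX ler_nat ltnW// ltn_expl.
Qed.

(** * Bad approximability of the square root of 2 *)

Lemma sqrt2_irrational (x y : int) : x ^+ 2 = 2 * y ^+ 2 -> y = 0.
Proof.
move=> xy; apply/eqP; rewrite -absz_eq0; apply/eqP/eqP; rewrite -[_ == _]negbK -lt0n.
apply/negP => y0.
have xyN : (`|x| ^ 2 = 2 * `|y| ^ 2)%N by rewrite -!abszX xy abszM.
have x0 : (0 < `|x|)%N by move: xyN y0; rewrite -!mulnn; nia.
(* The exponent of 2 is even on the left and odd on the right. *)
have := congr1 (logn 2) xyN.
rewrite lognM ?expn_gt0 ?y0// !lognX (_ : logn 2 2 = 1%N)//; lia.
Qed.

(** The product with the conjugate is the nonzero integer [x ^ 2 - 2 * y ^ 2], so a small number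
    needs a large conjugate. *)
Lemma sqrt2_badly_approximable (R : realType) (x y : int) (m : nat) :
  (x != 0) || (y != 0) -> (`|y| < 2 ^ m)%N ->
  2^-1 ^+ m.+2 <= `|x%:~R + Num.sqrt 2 * y%:~R : R|.
Proof.
move=> xy0 ym; set q : R := Num.sqrt 2.
have q2 : q ^+ 2 = 2 by rewrite sqr_sqrtr.
have q0 : 0 <= q by exact: sqrtr_ge0.
have q32 : q <= 3 / 2 by nra.
rewrite leNgt; apply/negP => small.
set z := x%:~R + q * y%:~R in small.
have zz : 1 <= `|z * (x%:~R - q * y%:~R)|.
  have -> : z * (x%:~R - q * y%:~R) = (x ^+ 2 - 2 * y ^+ 2)%:~R.
    by rewrite /z !expr2 intrB !intrM -[2%:~R]/(2%:R : R) -q2; ring.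
  rewrite -intr_norm (ler_int _ 1).
  have : x ^+ 2 - 2 * y ^+ 2 != 0.
    rewrite subr_eq0; apply/negP => /eqP xy; have y0 := sqrt2_irrational xy.
    by move: xy xy0; rewrite y0 eqxx orbF expr0n mulr0 => /eqP; rewrite expf_eq0/= => ->.
  by lia.
have yb : `|y%:~R : R| <= 2 ^+ m.
  by rewrite -intr_norm -natrX -[(_ ^ _)%:R]/((2 ^ m)%N%:~R) ler_int; lia.
have hm : 2^-1 ^+ m.+2 * 2 ^+ m = 4^-1 :> R.
  by rewrite !exprS -!mulrA -exprMn mulVf// expr1n; lra.
have h4 : 2^-1 ^+ m.+2 <= 4^-1 :> R.
  by apply: le_trans (exp_half_le R (_ : 2 <= m.+2)%N) _ => //; rewrite exprVn; lra.
(* Smallness of [z] replaces a bound on [x]: the conjugate is [z - 2 * q * y]. *)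
have zle : `|x%:~R - q * y%:~R| <= 4 * 2 ^+ m.
  rewrite (_ : x%:~R - q * y%:~R = z - 2 * q * y%:~R); last by rewrite /z; ring.
  apply: le_trans (ler_normB _ _) _; rewrite normrM ger0_norm ?mulr_ge0//.
  have : 2 * q * `|y%:~R| <= 3 * 2 ^+ m.
    by apply: ler_pM => //; rewrite ?mulr_ge0//; lra.
  have : (1 : R) <= 2 ^+ m by rewrite exprn_ege1// ler1n.
  by lra.
move: zz; rewrite normrM leNgt => /negP; apply.
have p0 : 0 < 4 * 2 ^+ m :> R by rewrite mulr_gt0// exprn_gt0.
apply: le_lt_trans (ler_wpM2l (normr_ge0 _) zle) _.
rewrite -ltr_pdivlMr// mul1r invfM -hm; move: small.
have -> : 2^-1 ^+ m.+2 * 2 ^+ m * (2 ^+ m)^-1 = 2^-1 ^+ m.+2 :> R.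
  by rewrite mulfK// expf_neq0.
by [].
Qed.

Definition ap_digits (R : realType) (K : nat) (l : nat -> nat) (k : nat) : seq R :=
  [seq a%:R * 2^-1 ^+ level K k.+1 | a <- iota 0 (2 ^ l k)].

(** Digits of a part of [A + sqrt 2 A]. The range of [b] has its own exponent [m k], so that
    [l k + m k] bits can be made to fit into one block. *)
Definition quad_digits (R : realType) (K : nat) (l m : nat -> nat) (k : nat) : seq R :=
  [seq (a%:R + Num.sqrt 2 * b%:R) * 2^-1 ^+ level K k.+1 |
    a <- iota 0 (2 ^ l k), b <- iota 0 (2 ^ m k)].

Lemma ap_digits0 (R : realType) (K : nat) (l : nat -> nat) (k : nat) :
  0 \in ap_digits R K l k.
Proof. by apply/mapP; exists 0%N; rewrite ?mul0r// mem_iota expn_gt0. Qed.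

Lemma digits_ap (R : realType) (K : nat) (l : nat -> nat) :
  (forall k, (l k <= k + K)%N) ->
  digits (ap_digits R K l) (fun k => 2^-1 ^+ level K k).
Proof.
move=> lK k; split; first by rewrite exprn_ge0.
move=> x /mapP[a]; rewrite mem_iota add0n => /andP[_ al] ->.
split; first by rewrite mulr_ge0// exprn_ge0.
rewrite -[X in _ + X]mul1r -mulrDl natr1 levelS exprD mulrCA.
rewrite ler_piMr ?exprn_ge0// exprVn ler_pdivrMr ?exprn_gt0// mul1r.
by rewrite -natrX ler_nat (leq_trans al)// leq_pexp2l.
Qed.

(** This tail bound at [k.+1] is at most half the gap [2^-(level K k.+1 + m k + 2)] between digits
    of rank [k]; the six spare places in each block make the digits fit under it. *)
Lemma digits_quad (R : realType) (K : nat) (l m : nat -> nat) :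
  (forall k, (l k + m k + 6 <= k + K)%N) -> (forall k, (m k <= l k)%N) ->
  (forall k, (m k <= m k.+1)%N) ->
  digits (quad_digits R K l m) (fun k => 2^-1 ^+ (level K k + m k + 3)).
Proof.
move=> lmK ml mS k; split; first by rewrite exprn_ge0.
move=> x /allpairsP[[a b] /= []]; rewrite !mem_iota !add0n => /andP[_ al] /andP[_ bm] ->.
set q : R := Num.sqrt 2.
have q2 : q ^+ 2 = 2 by rewrite sqr_sqrtr.
have q0 : 0 <= q by exact: sqrtr_ge0.
have q32 : q <= 2 by nra.
split; first by rewrite !mulr_ge0 ?addr_ge0 ?mulr_ge0 ?exprn_ge0.
rewrite levelS; set L := (k + K)%N.
rewrite -!addnA !(exprD _ (level K k)) mulrCA -mulrDr ler_wpM2l ?exprn_ge0//.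
(* In units of the target [X], the digit takes at most 3/8 and the tail at most 1/2. *)
pose X : R := 2^-1 ^+ (m k + 3).
have X0 : 0 <= X by rewrite exprn_ge0.
have h3 : 2^-1 ^+ 3 = 8^-1 :> R by rewrite exprVn; congr (_^-1); lra.
have lL : 2 ^+ l k * 2^-1 ^+ L <= X / 8.
  rewrite (_ : L = l k + (L - l k))%N; last by have := lmK k; rewrite /L; lia.
  rewrite exprD mulrA -exprMn mulfV// expr1n mul1r -h3 -exprD.
  by apply: exp_half_le; have := lmK k; rewrite /L; lia.
have tl : 2^-1 ^+ (L + (m k.+1 + 3)) <= X / 2.
  rewrite -[X in _ / X]expr1 -exprVn -exprD; apply: exp_half_le.
  by have := lmK k; have := mS k; rewrite /L; lia.
have ab : a%:R + q * b%:R <= 3 * 2 ^+ l k.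
  have aX : (a%:R : R) <= 2 ^+ l k by rewrite -natrX ler_nat ltnW.
  have bX : (b%:R : R) <= 2 ^+ l k.
    by rewrite -natrX ler_nat (leq_trans (ltnW bm))// leq_pexp2l.
  have : q * b%:R <= 2 * 2 ^+ l k by apply: ler_pM.
  by lra.
have hL : 0 <= 2^-1 ^+ L :> R by rewrite exprn_ge0.
have abL := ler_wpM2r hL ab.
rewrite (addnA k K) -/L -/X; apply: le_trans (lerD abL tl) _; rewrite -mulrA.
by have := ler_wpM2l (ler0n R 3) lL; lra.
Qed.

Lemma quad_digits_sep (R : realType) (K : nat) (m : nat -> nat) (k : nat)
  (a b a' b' : nat) :
  (b < 2 ^ m k)%N -> (b' < 2 ^ m k)%N -> (a, b) != (a', b') ->
  2^-1 ^+ (level K k.+1 + m k + 2) <=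
  `|(a%:R + Num.sqrt 2 * b%:R) * 2^-1 ^+ level K k.+1 -
    (a'%:R + Num.sqrt 2 * b'%:R) * 2^-1 ^+ level K k.+1 : R|.
Proof.
move=> bm b'm ab; rewrite -mulrBl normrM [X in _ * X]ger0_norm ?exprn_ge0//.
rewrite -addnA exprD mulrC ler_wpM2r ?exprn_ge0// addn2.
have -> : a%:R + Num.sqrt 2 * b%:R - (a'%:R + Num.sqrt 2 * b'%:R) =
    (a%:Z - a'%:Z)%:~R + Num.sqrt 2 * (b%:Z - b'%:Z)%:~R :> R.
  by rewrite !intrB; ring.
apply: sqrt2_badly_approximable; last by lia.
apply: contraNT ab; rewrite negb_or !negbK !subr_eq0 !eqz_nat => /andP[/eqP -> /eqP ->].
exact: eqxx.
Qed.

Lemma uniq_quad_digits (R : realType) (K : nat) (l m : nat -> nat) (k : nat) :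
  uniq (quad_digits R K l m k).
Proof.
apply: allpairs_uniq; rewrite ?iota_uniq//.
move=> [a b] [a' b'] /allpairsP[[? ?] /= [_ + [-> ->]]] /allpairsP[[? ?] /= [_ + [-> ->]]].
rewrite !mem_iota !add0n => /andP[_ bm] /andP[_ b'm] /= /eqP abE.
apply/eqP; apply: contraTT abE => /(quad_digits_sep R K bm b'm) sep.
by rewrite -subr_eq0 -normr_gt0 (lt_le_trans _ sep)// exprn_gt0.
Qed.

Lemma size_quad_digits (R : realType) (K : nat) (l m : nat -> nat) (k : nat) :
  size (quad_digits R K l m k) = (2 ^ (l k + m k))%N.
Proof. by rewrite size_allpairs !size_iota expnD. Qed.

(** The test points are all digit sums of a large length. A ball of radius between [2^-(a k.+1)] and
    [2^-(a k)] fixes the first [k.+1] digits, so it holds a fraction at most [2^-(S k.+1)] of them;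
    and [S k.+1 >= t * a k.+1] for large [k], because [t < w]. *)
Lemma spread_quad (R : realType) (K : nat) (l m : nat -> nat) (w t : R) (A : set R) :
  (forall k, (l k + m k + 6 <= k + K)%N) -> (forall k, (m k <= l k)%N) ->
  (forall k, (m k <= m k.+1)%N) ->
  (forall k, w * (k + K)%:R - 2 <= (l k + m k)%:R) -> 0 < t -> t < w ->
  (forall n x, x \in gsum (quad_digits R K l m) n -> A x) -> spread A t.
Proof.
move=> lmK ml mS wlm t0 tw GA; set G := quad_digits R K l m.
have GT := digits_quad R lmK ml mS.
(* [2^-(a k)] is one eighth of the gap between digits of rank [k]; with a tail of at most half the
   gap, [2 * rho] still fits. *)
pose a k := (level K k.+1 + m k + 5)%N.
pose S k := (\sum_(j < k) (l j + m j))%N.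
have aS k : (a k <= a k.+1)%N.
  by rewrite /a [level K k.+2]levelS; have := mS k; lia.
have aM j k : (j <= k)%N -> (a j <= a k)%N.
  by move=> /subnK <-; elim: (k - j)%N => // n IHn; apply: leq_trans IHn (aS _).
have ak k : (k <= a k)%N by rewrite /a levelS; have := level_quadratic K k; lia.
have SE k : w * (level K k)%:R - 2 * k%:R <= (S k)%:R.
  elim: k => [|k IHk]; first by rewrite /level /S !big_ord0; lra.
  rewrite levelS /S big_ord_recr/= -/(S k) natrD [X in _ <= X]natrD.
  by have := wlm k; rewrite -(natr1 k); lra.
have wt0 : 0 < w - t by rewrite subr_gt0.
(* Linear losses: 2 per block from the rounding in [wlm], and [2 * K + 7] per block from replacing
   [a k.+1] by [level K k.+1], weighted by [t]. *)
have [k0 k0P] := level_superlinear K ((2 + t * (2 * K%:R + 7)) / (w - t)).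
have aSk k : (k0 <= k)%N -> t * (a k.+1)%:R <= (S k.+1)%:R.
  move=> k0k; apply: le_trans (SE _).
  have := k0P _ (leqW k0k); rewrite mulrAC ler_pdivrMr// mulrC.
  have mK : (m k.+1 <= k.+1 + K)%N by have := lmK k.+1; lia.
  have aE : (a k.+1)%:R <= (level K k.+1)%:R + (2 * K%:R + 7) * k.+2%:R :> R.
    have : (a k.+1 <= level K k.+1 + (2 * K + 7) * k.+2)%N by rewrite /a levelS; nia.
    by rewrite -(ler_nat R) natrD natrM natrD natrM.
  have := ler_wpM2l (ltW t0) aE.
  have : (k.+1%:R : R) <= k.+2%:R by rewrite ler_nat.
  by lra.
pose rho0 : R := 2^-1 ^+ a k0.
have rho00 : 0 < rho0 by rewrite exprn_gt0.
(* The second summand makes the bound trivial for radii at least [rho0]. *)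
exists (1 + rho0 `^ (- t)); first by rewrite ltr_wpDr ?powR_ge0.
move=> r r0; have [n hnr] := exp_half_unbounded r0.
have nr : 2^-1 ^+ a n <= r by apply: le_trans hnr; apply: exp_half_le.
exists (gsum G n); split; last 1 first.
- move=> x rho rrho; have rho_gt0 : 0 < rho by exact: lt_le_trans rrho.
  have N0 : 0 <= (size (gsum G n))%:R :> R by [].
  have [rho0rho|rhorho0] := leP rho0 rho.
    apply: (@le_trans _ _ (1 * (size (gsum G n))%:R)); first by rewrite mul1r ler_nat count_size.
    rewrite ler_wpM2r// mulrDl; apply: ler_wpDl; first by rewrite mul1r powR_ge0.
    rewrite powRN mulrC ler_pdivlMr ?powR_gt0// mul1r.
    by apply: ge0_ler_powR; rewrite ?nnegrE ?(ltW t0) ?(ltW rho00) ?(ltW rho_gt0).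
  (* The least such index exceeds [k0]; its minimality puts [rho] between two consecutive scales. *)
  have exk : exists k, 2^-1 ^+ a k <= rho by exists n; exact: le_trans rrho.
  have [k' k'rho k'min] := ex_minnP exk.
  have k0k' : (k0 < k')%N.
    rewrite ltnNge; apply/negP => /aM/(exp_half_le R) k'k0.
    by have := lt_le_trans rhorho0 (le_trans k'k0 k'rho); rewrite ltxx.
  case: k' => // k in k'rho k'min k0k' *.
  have rhok : rho < 2^-1 ^+ a k.
    by rewrite ltNge; apply/negP => /k'min; rewrite ltnn.
  have kn : (k < n)%N by apply: k'min; exact: le_trans rrho.
  pose sigma j : R := 2^-1 ^+ (level K j.+1 + m j + 2).
  have sepG j : (j < k.+1)%N -> [/\ uniq (G j),
      2 * rho + 2^-1 ^+ (level K j.+1 + m j.+1 + 3) < sigma j &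
      forall a b, a \in G j -> b \in G j -> a != b -> sigma j <= `|a - b|].
    rewrite /sigma => jk; split; [exact: uniq_quad_digits| |].
      have rhoj : rho < 2^-1 ^+ a j.
        by apply: lt_le_trans rhok _; apply: exp_half_le; exact: aM.
      have hj : 2^-1 ^+ (level K j.+1 + m j.+1 + 3) <= 2^-1 ^+ (level K j.+1 + m j + 3) :> R.
        by apply: exp_half_le; have := mS j; lia.
      move: rhoj hj; rewrite /a 3!(exprD _ (level K j.+1 + m j)).
      have : 0 < 2^-1 ^+ (level K j.+1 + m j) :> R by rewrite exprn_gt0.
      rewrite !exprS expr0. lra.
    move=> _ _ /allpairsP[[a1 b1] /= [_ b1m ->]] /allpairsP[[a2 b2] /= [_ b2m ->]].
    move=> ne; apply: quad_digits_sep.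
    - by move: b1m; rewrite mem_iota.
    - by move: b2m; rewrite mem_iota.
    - by apply: contraNneq ne => -[-> ->].
  have := count_gsum x GT sepG kn.
  under eq_bigr do rewrite size_quad_digits.
  rewrite -expn_sum -/(S k.+1) -(ler_nat R) natrM natrX => cnt.
  have rhoS : 2^-1 ^+ S k.+1 <= rho `^ t.
    apply: (@le_trans _ _ ((2^-1 ^+ a k.+1) `^ t)); last first.
      by apply: ge0_ler_powR; rewrite ?nnegrE ?(ltW t0) ?(ltW rho_gt0) ?exprn_ge0.
    rewrite -!powR_mulrn// -powRrM; apply: ger_powR; first by lra.
    by rewrite mulrC; exact: aSk.
  apply: (@le_trans _ _ (2^-1 ^+ S k.+1 * (size (gsum G n))%:R)).
    by rewrite exprVn mulrC ler_pdivlMr ?exprn_gt0.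
  rewrite ler_wpM2r//; apply: le_trans rhoS _.
  by rewrite mulrDl mul1r lerDl mulr_ge0 ?powR_ge0.
- rewrite size_gsum; by apply: prodn_gt0 => i; rewrite size_quad_digits expn_gt0.
- by move=> p /GA.
Qed.

(** * Coverings of [A + xi A] at the scales of the blocks *)

Definition ap_set (R : realType) (K : nat) (l : nat -> nat) : set R :=
  gset (ap_digits R K l) (fun k => 2^-1 ^+ level K k).
Arguments ap_set : clear implicits.

(** For [a, b < 2 ^ l k] the number [a + (p / q) b] is [c / q] with [c] in an integer window of
    length [(q + 2|p|) * 2 ^ l k]. So each block costs at most [h] bits beyond its [l k] free
    ones. *)
Lemma cover_lin_sum (R : realType) (K : nat) (l : nat -> nat) (n h q : nat)
  (p : int) (xi : R) :
  (forall k, (l k <= k + K)%N) -> (0 < q)%N -> (q + 2 * `|p| <= 2 ^ h)%N ->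
  `|xi - p%:~R / q%:R| <= 2^-1 ^+ level K n ->
  coverable (lin_sum (ap_set R K l) xi) ((3 + `|xi|) * 2^-1 ^+ level K n)
    (2 ^+ (h * n + \sum_(k < n) l k)).
Proof.
move=> lK q0 qp xipq; set eta := 2^-1 ^+ level K n in xipq *.
set xi' := p%:~R / q%:R in xipq.
have eta0 : 0 <= eta by rewrite exprn_ge0.
have eta1 : eta <= 1 by rewrite exprn_ile1//; lra.
have q0R : (q%:R : R) != 0 by rewrite pnatr_eq0 -lt0n.
(* The shift by [|p| * 2 ^ l k] makes the numerators natural numbers when [p] is negative. *)
pose D' k := [seq (c%:R - (`|p| * 2 ^ l k)%:R) / q%:R * 2^-1 ^+ level K k.+1 |
  c <- iota 0 (2 ^ (h + l k))] : seq R.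
exists (gsum D' n); split.
  rewrite size_gsum; under eq_bigr do rewrite size_map size_iota.
  rewrite -expn_sum natrX big_split/= sum_nat_const card_ord mulnC.
  exact: lexx.
move=> _ [x Ax [y Ay <-]].
have [x1 x1D /andP[x1x xx1]] := Ax n; have [y1 y1D /andP[y1y yy1]] := Ay n.
have /andP[y0 y1'] := gset_bound Ay.
rewrite /level big_ord0 expr0 in y1'.
rewrite -/eta in xx1 yy1.
exists (x1 + xi' * y1).
  apply: gsum_lin x1D y1D => k _ _ /mapP[a + ->] /mapP[b + ->].
  rewrite !mem_iota !add0n => /andP[_ al] /andP[_ bl].
  pose c : int := q%:Z * a%:Z + p * b%:Z + (`|p| * 2 ^ l k)%N%:Z.
  have pb : - (`|p| * 2 ^ l k)%N%:Z <= p * b%:Z <= (`|p| * 2 ^ l k)%N%:Z.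
    by rewrite PoszM; nia.
  have c0 : 0 <= c by rewrite /c; nia.
  have cE : c = `|c|%N%:Z by rewrite gez0_abs.
  apply/mapP; exists `|c|%N.
    rewrite mem_iota add0n/= expnD.
    have : (q * a + 2 * (`|p| * 2 ^ l k) < 2 ^ h * 2 ^ l k)%N by nia.
    by rewrite /c; lia.
  have -> : `|c|%:R = c%:~R :> R by rewrite [in RHS]cE.
  rewrite /c !intrD !intrM -!pmulrn /xi'; field.
  by rewrite q0R.
(* Truncating [x] costs [eta], replacing [xi] by [xi'] costs [eta] since [y <= 1], and truncating
   [y] costs [(|xi| + 1) * eta]. *)
have -> : x + xi * y - (x1 + xi' * y1) = (x - x1) + (xi - xi') * y + xi' * (y - y1).
  by ring.
have H1 : `|x - x1| <= eta by rewrite ger0_norm; lra.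
have H2 : `|(xi - xi') * y| <= eta.
  rewrite normrM (ger0_norm y0) -[leRHS]mulr1.
  by apply: ler_pM.
have xi'b : `|xi'| <= `|xi| + 1.
  rewrite -[xi'](subrK xi) addrC; apply: le_trans (ler_normD _ _) _.
  by rewrite lerD2l distrC (le_trans xipq).
have H3 : `|xi' * (y - y1)| <= (`|xi| + 1) * eta.
  by rewrite normrM; apply: ler_pM => //; rewrite ger0_norm; lra.
apply: le_trans (ler_normD _ _) _.
apply: (@le_trans _ _ (eta + eta + (`|xi| + 1) * eta)); last by lra.
apply: lerD => //; apply: le_trans (ler_normD _ _) _; exact: lerD.
Qed.

(** Converts a count of bits into a power of the scale; [c] accounts for the constant factor in the
    radius. *)
Lemma exp2_le_powRN (R : realType) (rho v : R) (c M N : nat) :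
  0 < rho -> rho <= 2 ^+ c * 2^-1 ^+ M -> 0 <= v ->
  N%:R <= v * (M%:R - c%:R) -> 2 ^+ N <= rho `^ (- v).
Proof.
move=> rho0 rhoM v0 NM.
have rhoE : rho <= 2 `^ (c%:R - M%:R).
  by rewrite powRB ?pnatr_eq0 ?implybT// !powR_mulrn// -exprVn.
apply: (@le_trans _ _ (2 `^ (v * (M%:R - c%:R)))).
  by rewrite -powR_mulrn//; apply: ler_powR => //; rewrite ler1n.
have -> : v * (M%:R - c%:R) = - ((c%:R - M%:R) * v) by ring.
rewrite !powRN lef_pV2 ?posrE ?powR_gt0// powRrM.
by apply: ge0_ler_powR; rewrite ?nnegrE ?powR_ge0// ltW.
Qed.

Lemma sum_level_le (R : realType) (K : nat) (l : nat -> nat) (u : R) (n : nat) :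
  (forall k, (l k)%:R <= u * (k + K)%:R) ->
  (\sum_(k < n) l k)%:R <= u * (level K n)%:R.
Proof.
move=> lu; rewrite /level !natr_sum mulr_sumr.
by apply: ler_sum => k _; exact: lu.
Qed.

Lemma nat_exp2_ge (R : realType) (x : R) : exists c : nat, x <= 2 ^+ c.
Proof.
exists (Num.trunc x).+1; apply: le_trans (ltW (truncnS_gt x)) _.
by rewrite -natrX ler_nat ltnW// ltn_expl.
Qed.

(** For a rational the same fraction is exact at all levels, so [h] is fixed and the extra cost
    [h * n] is only linear in the number of blocks. *)
Lemma upper_box_dim_rat (R : realType) (d K : nat) (l : nat -> nat) (u : R) (r : rat) :
  (1 <= d)%N -> 0 <= u -> (forall k, (l k <= k + K)%N) ->
  (forall k, (l k)%:R <= u * (k + K)%:R) ->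
  (upper_box_dim (cube d (lin_sum (ap_set R K l) (ratr r))) <= (d%:R * u)%:E)%E.
Proof.
move=> d1 u0 lK lu; apply: upper_box_dim_cube => // e e0.
set xi : R := ratr r; set C := 3 + `|xi|.
have C0 : 0 < C by rewrite ltr_wpDr.
have [c Cc] := nat_exp2_ge C.
pose q := `|denq r|%N; pose p := numq r.
have q0 : (0 < q)%N by rewrite absz_gt0.
have xiE : xi = p%:~R / q%:R.
  by rewrite /xi /ratr -/p [q%:R]pmulrn /q absz_denq.
have [h hqp] : exists h, (q + 2 * `|p| <= 2 ^ h)%N.
  by exists (q + 2 * `|p|)%N; exact/ltnW/ltn_expl.
(* The three terms pay for the [h] extra bits per block, for one more block since [rho] lies between
   consecutive levels, and for the constant [C]. *)
have [k0 k0P] := level_superlinear K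
  ((h%:R + u * (1 + K%:R) + (u + e) * c%:R) / e).
exists (C * 2^-1 ^+ level K k0); first by rewrite mulr_gt0 ?exprn_gt0.
move=> rho rho0 rhok0.
have exn : exists n, C * 2^-1 ^+ level K n <= rho.
  have [n nrho] := exp_half_unbounded (divr_gt0 rho0 C0).
  exists n.+1; rewrite mulrC -ler_pdivlMr//; apply: le_trans nrho.
  by apply: exp_half_le; have := level_quadratic K n.+1; nia.
have [n nrho nmin] := ex_minnP exn.
have k0n : (k0 < n)%N.
  rewrite ltnNge; apply/negP => /(leq_level K)/(exp_half_le R) nk0.
  have := lt_le_trans rhok0 (le_trans (ler_wpM2l (ltW C0) nk0) nrho).
  by rewrite ltxx.
case: n => // n in nrho nmin k0n *.
have rhon : rho < C * 2^-1 ^+ level K n.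
  by rewrite ltNge; apply/negP => /nmin; rewrite ltnn.
have [P [Psize Pcov]] := @cover_lin_sum R K l n.+1 h q p xi lK q0 hqp
  ltac:(by rewrite -xiE subrr normr0 exprn_ge0).
exists P; split; last first.
  by move=> x /Pcov[y yP xy]; exists y => //; exact: le_trans xy _.
apply: le_trans Psize _; apply: (@exp2_le_powRN _ _ _ c (level K n)) => //.
- apply: le_trans (ltW rhon) _; apply: ler_wpM2r => //; by rewrite exprn_ge0.
- by rewrite addr_ge0// ltW.
have := k0P n k0n; rewrite mulrAC ler_pdivrMr// => kn.
have := sum_level_le n.+1 lu; rewrite levelS natrD => sl.
rewrite natrD natrM; apply: le_trans (lerD (lexx _) sl) _.
have uc : 0 <= (u + e) * c%:R by rewrite mulr_ge0// addr_ge0// ltW.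
have n1 : 1 <= n.+1%:R :> R by rewrite ler1n.
have := ler_wpM2l uc n1.
have : u * (n + K)%:R <= u * ((1 + K%:R) * n.+1%:R).
  by apply: ler_wpM2l => //; rewrite -(natrD _ 1) -natrM ler_nat; nia.
by lra.
Qed.

(* Since [level K n] is quadratic in [n], the height [2 ^ h] of [p / q] costs
   only a factor [2 ^ (h * n)], negligible at scale [2 ^ - level K n]. *)
Definition superapprox (R : realType) (K : nat) (xi : R) : Prop :=
  forall j : nat, exists n q h : nat, exists p : int,
    [/\ (j <= n)%N, (0 < q)%N, (q + 2 * `|p| <= 2 ^ h)%N,
        (h * n * j <= level K n)%N & `|xi - p%:~R / q%:R| <= 2^-1 ^+ level K n].

(** A lower limit needs good coverings only along a sequence of scales, here the levels provided by
    [superapprox]. *)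
Lemma lower_box_dim_superapprox (R : realType) (d K : nat) (l : nat -> nat)
  (u xi : R) :
  (1 <= d)%N -> 0 <= u -> (forall k, (l k <= k + K)%N) ->
  (forall k, (l k)%:R <= u * (k + K)%:R) -> superapprox K xi ->
  (lower_box_dim (cube d (lin_sum (ap_set R K l) xi)) <= (d%:R * u)%:E)%E.
Proof.
move=> d1 u0 lK lu xiP; apply: lower_box_dim_cube => // e r e0 r0.
set C := 3 + `|xi|.
have C0 : 0 < C by rewrite ltr_wpDr.
have [c Cc] := nat_exp2_ge C.
have [k0 k0P] := level_superlinear K ((u + e) * c%:R / (e / 2)).
(* Halving the bound makes the later inequality strict. *)
have [k1 k1r] := exp_half_unbounded (divr_gt0 (divr_gt0 r0 C0) (ltr0Sn R 1)).
(* [k1.+1] because [level_quadratic] yields only [level K n >= n - 1]; the last term makes [h * n]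
   at most [e / 2] times the level. *)
pose j := maxn (maxn k0 k1.+1) (Num.trunc (2 / e)).+1.
have [n [q [h [p [jn q0 hqp hnj xipq]]]]] := xiP j.
have k0n : (k0 <= n)%N by rewrite (leq_trans _ jn)// /j !leq_max leqnn.
have k1n : (k1 < n)%N by rewrite (leq_trans _ jn)// /j !leq_max leqnn orbT.
exists (C * 2^-1 ^+ level K n); split.
- by rewrite mulr_gt0 ?exprn_gt0.
- rewrite mulrC -ltr_pdivlMr//.
  apply: (@le_lt_trans _ _ (r / C / 2)); last first.
    have : 0 < r / C by rewrite divr_gt0.
    by lra.
  apply: le_trans k1r; apply: exp_half_le.
  by have := level_quadratic K n; nia.
have [P [Psize Pcov]] := cover_lin_sum lK q0 hqp xipq.
exists P; split => //; apply: le_trans Psize _.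
apply: (@exp2_le_powRN _ _ _ c (level K n)) => //.
- by rewrite mulr_gt0 ?exprn_gt0.
- by apply: ler_wpM2r => //; rewrite exprn_ge0.
- by rewrite addr_ge0// ltW.
have := k0P n k0n; rewrite mulrAC ler_pdivrMr ?divr_gt0// => kn.
rewrite natrD; apply: le_trans (lerD (lexx _) (sum_level_le n lu)) _.
have ej : 2 / e <= j%:R.
  apply: le_trans (ltW (truncnS_gt _)) _.
  by rewrite ler_nat /j leq_max leqnn orbT.
have : (h * n)%:R <= e / 2 * (level K n)%:R.
  rewrite -ler_pdivrMl ?divr_gt0// invf_div.
  apply: (@le_trans _ _ (h * n * j)%:R); last by rewrite ler_nat.
  by rewrite [leRHS]natrM mulrC; apply: ler_wpM2l.
have uc : 0 <= (u + e) * c%:R by rewrite mulr_ge0// addr_ge0// ltW.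
have n1 : 1 <= n.+1%:R :> R by rewrite ler1n.
have := ler_wpM2l uc n1.
by lra.
Qed.

(** * Splitting sqrt 2 *)

(** The condition of [superapprox] for a single [j], made strict so that it defines an open set. *)
Definition superapprox_step (R : realType) (K j : nat) : set R :=
  [set xi | exists n q h : nat, exists p : int,
    [/\ (j <= n)%N, (0 < q)%N, (q + 2 * `|p| <= 2 ^ h)%N,
        (h * n * j <= level K n)%N & `|xi - p%:~R / q%:R| < 2^-1 ^+ level K n]].
Arguments superapprox_step : clear implicits.

Lemma open_superapprox_step (R : realType) (K j : nat) :
  open (superapprox_step R K j).
Proof.
rewrite openE => xi [n [q [h [p [jn q0 hqp hnj xipq]]]]]; apply/nbhs_ballP.
exists (2^-1 ^+ level K n - `|xi - p%:~R / q%:R|); first by rewrite /= subr_gt0.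
move=> x; rewrite /ball/= => xix; exists n, q, h, p; split => //.
rewrite -(subrK xi x) -addrA; apply: le_lt_trans (ler_normD _ _) _.
by rewrite distrC -ltrBrDr.
Qed.

(** It contains every rational: [h] is then fixed, and the level eventually exceeds [h * n * j]. *)
Lemma dense_superapprox_step (R : realType) (K j : nat) :
  dense (superapprox_step R K j).
Proof.
move=> O O0 oO; have [x [Ox [r _ rx]]] := dense_rat O0 oO.
exists x; split => //; rewrite -rx.
have [h hqp] : exists h, (`|denq r| + 2 * `|numq r| <= 2 ^ h)%N.
  by exists (`|denq r| + 2 * `|numq r|)%N; exact/ltnW/ltn_expl.
have [k0 k0P] := level_superlinear K ((h * j)%:R : R).
exists (maxn k0 j), `|denq r|%N, h, (numq r); split => //.
- by rewrite leq_maxr.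
- by rewrite absz_gt0.
- have := k0P _ (leq_maxl k0 j); rewrite -natrM ler_nat; nia.
- by rewrite /ratr [_%:R]pmulrn absz_denq subrr normr0 exprn_gt0.
Qed.

(* The super-approximable numbers form a dense G_delta, hence so does their
   image under [x |-> a - x] and the two meet. *)
Lemma superapprox_decomp (R : realType) (K : nat) (a : R) :
  exists x y : R, [/\ superapprox K x, superapprox K y & x + y = a].
Proof.
have cont_sub : continuous (fun x : R => a - x).
  by move=> x; apply: continuousB; [exact: cst_continuous|exact: cvg_id].
move/continuousP in cont_sub.
pose V j : set R := (fun x : R => a - x) @^-1` superapprox_step R K j.
have oV j : open (V j).
  exact/cont_sub/open_superapprox_step.
have dV j : dense (V j).
  move=> O [x Ox] oO.
  have [|//|y [Oy Uy]] := @dense_superapprox_step R K j ((fun x : R => a - x) @^-1` O).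
  - by exists (a - x); rewrite /= subKr.
  - exact: cont_sub.
  - by exists (a - y); split => //; rewrite /V/= subKr.
have : dense (\bigcap_j (superapprox_step R K j `&` V j)).
  apply: (@Baire R R^o) => j; split.
    by apply: openI; [exact: open_superapprox_step|exact: oV].
  apply: denseI; [exact: open_superapprox_step|exact: dense_superapprox_step|exact: dV].
move=> /(_ setT)[||x [_ xUV]]; first by exists 0.
  exact: openT.
exists x, (a - x); split; last by rewrite addrC subrK.
- move=> j; have [[n [q [h [p [? ? ? ? /ltW ?]]]]] _] := xUV j I.
  by exists n, q, h, p.
- move=> j; have [_ [n [q [h [p [? ? ? ? /ltW ?]]]]]] := xUV j I.
  by exists n, q, h, p.
Qed.

(** * Assembling the set and its dimensions *)

Lemma is_subfieldD (R : realType) (S : set R) (x y : R) :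
  is_subfield S -> S x -> S y -> S (x + y).
Proof.
move=> [S1 SB _] Sx Sy.
have S0 : 0 \in S by rewrite -(subrr 1); exact: SB.
have SN : - y \in S by rewrite -(sub0r y); apply: SB => //; exact/mem_set.
rewrite -(opprK y); apply/set_mem/SB => //; exact/mem_set.
Qed.

Lemma compact_lin_sum (R : realType) (A : set R) (xi : R) :
  compact A -> compact (lin_sum A xi).
Proof.
move=> Ac.
have -> : lin_sum A xi = (fun z : R * R => z.1 + xi * z.2) @` (A `*` A).
  apply/seteqP; split=> [_ [x Ax [y Ay <-]]|_ [[x y] [/= Ax Ay] <-]].
    by exists (x, y).
  by exists x => //; exists y.
apply: continuous_compact; last exact: compact_setX.
apply: continuous_subspaceT => z.
apply: continuousD; first exact: cvg_fst.
by apply: continuousM; [exact: cst_continuous|exact: cvg_snd].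
Qed.

Lemma truncn_mul_bounds (R : realType) (u : R) (n : nat) :
  0 <= u -> u * n%:R - 1 < (Num.trunc (u * n%:R))%:R <= u * n%:R.
Proof.
move=> u0; rewrite ltrBlDr natr1 truncnS_gt truncn_le.
by rewrite mulr_ge0.
Qed.

Lemma sub_lin_sum (R : realType) (K : nat) (l : nat -> nat) (xi : R) :
  (forall k, (l k <= k + K)%N) ->
  ap_set R K l `<=` lin_sum (ap_set R K l) xi.
Proof.
move=> lK x Ax; exists x => //; exists 0; last by rewrite mulr0 addr0.
apply: (@gsum_sub_gset _ _ _ 0%N); [exact: digits_ap|exact: ap_digits0|].
by rewrite /= inE.
Qed.

(** The case [m = 0] of [spread_quad], where [b = 0] is the only choice. *)
Lemma spread_ap_set (R : realType) (K : nat) (l : nat -> nat) (w t : R) :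
  (forall k, (l k + 6 <= k + K)%N) ->
  (forall k, w * (k + K)%:R - 2 <= (l k)%:R) -> 0 < t -> t < w ->
  spread (ap_set R K l) t.
Proof.
move=> lK wl t0 tw; apply: (@spread_quad R K l (fun=> 0%N) w t) => //.
- by move=> k; rewrite addn0.
- by move=> k; rewrite addn0.
move=> n x xG; apply: (@gsum_sub_gset _ _ _ n).
- by apply: digits_ap => k; have := lK k; lia.
- exact: ap_digits0.
apply: gsum_sub xG => k _ /allpairsP[[a b] /= [aI + ->]].
by rewrite inE => /eqP ->; rewrite mulr0 addr0; apply/mapP; exists a.
Qed.

Lemma spread_lin_sum_sqrt2 (R : realType) (K : nat) (l m : nat -> nat) (w t : R) :
  (forall k, (l k + m k + 6 <= k + K)%N) -> (forall k, (m k <= l k)%N) ->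
  (forall k, (m k <= m k.+1)%N) ->
  (forall k, w * (k + K)%:R - 2 <= (l k + m k)%:R) -> 0 < t -> t < w ->
  spread (lin_sum (ap_set R K l) (Num.sqrt 2)) t.
Proof.
move=> lmK ml mS wlm t0 tw; apply: (spread_quad lmK ml mS wlm t0 tw) => n x xG.
have DT : digits (ap_digits R K l) (fun k => 2^-1 ^+ level K k).
  by apply: digits_ap => k; have := lmK k; lia.
have [|p [q [pD qD ->]]] := gsum_split (D := ap_digits R K l) (xi := Num.sqrt 2) _ xG.
  move=> k g /allpairsP[[a b] /= [aI bI ->]].
  exists (a%:R * 2^-1 ^+ level K k.+1), (b%:R * 2^-1 ^+ level K k.+1); split.
  - by apply/mapP; exists a.
  - apply/mapP; exists b => //; move: bI; rewrite !mem_iota !add0n => /andP[_ bm].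
    by rewrite leq0n/= (leq_trans bm)// leq_pexp2l.
  - by ring.
exists p; first exact: (gsum_sub_gset DT (ap_digits0 R K l) pD).
by exists q => //; exact: (gsum_sub_gset DT (ap_digits0 R K l) qD).
Qed.

Theorem theorem1p2 (R : realType) (d : nat) (hd : (1 <= d)%N) (s : R)
    (hs0 : 0 < s) (hsd : s < d%:R) :
  exists E : set 'rV[R]_d,
    [/\ compact E,
        E `<=` @unit_cube R d,
        hausdorff_dim E = s%:E,
        has_box_dim E s%:E &
        [/\ range (@ratr R) `<=`
              [set xi : R | same_box_dim (set_sum E (set_scale xi E)) E],
            [set xi : R | same_box_dim (set_sum E (set_scale xi E)) E] `<`
              [set: R],
            ~ is_subfield
                [set xi : R |
                   hausdorff_dim (set_sum E (set_scale xi E)) =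
                   hausdorff_dim E] &
            ~ is_subfield
                [set xi : R |
                   lower_box_dim (set_sum E (set_scale xi E)) =
                   lower_box_dim E]]].
Proof.
have d0 : 0 < (d%:R : R) by rewrite ltr0n.
pose u := s / d%:R; have sE : s = d%:R * u by rewrite /u mulrC divfK ?gt_eqF.
have u0 : 0 < u by rewrite divr_gt0.
have u1 : u < 1 by rewrite ltr_pdivrMr// mul1r.
(* [v] is the additional density gained from [sqrt 2]: [v <= u] keeps [b] among the digits of [A],
   and [u + v < 1] leaves room in the blocks. *)
pose v := Num.min u (1 - u) / 2.
have v0 : 0 < v by rewrite divr_gt0// lt_min u0 subr_gt0.
have vu : v <= u.
  have : Num.min u (1 - u) <= u by rewrite ge_min lexx.
  by rewrite /v; lra.
have uv1 : u + v < 1.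
  have : Num.min u (1 - u) <= 1 - u by rewrite ge_min lexx orbT.
  by rewrite /v; lra.
(* Large enough for every block to keep the six spare places. *)
pose K := (Num.trunc (6 / (1 - u - v))).+1.
pose l k := Num.trunc (u * (k + K)%:R); pose m k := Num.trunc (v * (k + K)%:R).
have lP k := truncn_mul_bounds (k + K) (ltW u0).
have mP k := truncn_mul_bounds (k + K) (ltW v0).
have lmK k : (l k + m k + 6 <= k + K)%N.
  have K6 : 6 <= (1 - u - v) * (k + K)%:R.
    rewrite mulrC -ler_pdivrMr; last by lra.
    by apply: le_trans (ltW (truncnS_gt _)) _; rewrite ler_nat leq_addl.
  rewrite -(ler_nat R) !natrD -/K.
  have /andP[_] := lP k; have /andP[_] := mP k; rewrite -/(l k) -/(m k).
  by move: K6; rewrite !natrD; lra.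
have lK k : (l k <= k + K)%N by have := lmK k; lia.
have l6K k : (l k + 6 <= k + K)%N by have := lmK k; lia.
have ml k : (m k <= l k)%N by apply: le_truncn; rewrite ler_wpM2r.
have mS k : (m k <= m k.+1)%N.
  by apply: le_truncn; rewrite ler_wpM2l ?(ltW v0)// ler_nat addSn.
have ul k : (l k)%:R <= u * (k + K)%:R by have /andP[] := lP k.
have wl k : u * (k + K)%:R - 2 <= (l k)%:R.
  by have /andP[] := lP k; rewrite -/(l k); lra.
have wlm k : (u + v) * (k + K)%:R - 2 <= (l k + m k)%:R.
  rewrite [leRHS]natrD.
  by have /andP[+ _] := lP k; have /andP[+ _] := mP k; rewrite -/(l k) -/(m k); lra.
pose A := ap_set R K l; pose E := cube d A.
have Ac : compact A by exact: compact_gset.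
pose F xi := cube d (lin_sum A xi).
have FE xi : set_sum E (set_scale xi E) = F xi by exact: set_sum_cube.
have EF xi : E `<=` F xi by apply: le_cube; exact: sub_lin_sum.
have F0 : F 0 = E.
  apply/seteqP; split; last exact: EF.
  by apply: le_cube => _ [x Ax [y _ <-]]; rewrite mul0r addr0.
have sdimE : (s%:E <= hausdorff_dim E)%E.
  apply/lee_addgt0Pr => e e0.
  (* [spread] holds only for exponents below [u]; the maximum with [u / 2] keeps [t] positive. *)
  pose t := Num.max (u - e / d%:R) (u / 2).
  have ed0 : 0 < e / d%:R by rewrite divr_gt0.
  have t0 : 0 < t by rewrite lt_max [X in _ || X]divr_gt0 ?orbT.
  have tu : t < u by rewrite gt_max; apply/andP; split; lra.
  apply: (@le_trans _ _ ((d%:R * t)%:E + e%:E)%E); last first.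
    apply: leeD => //.
    by apply: spread_hausdorff_dim => //; apply: (spread_ap_set (w := u)).
  have : u - e / d%:R <= t by rewrite le_max lexx.
  rewrite -EFinD lee_fin sE -lerBlDr => /(ler_wpM2l (ltW d0)).
  by rewrite mulrBr [_ * (e / _)]mulrC divfK ?gt_eqF.
have sdimF xi : (s%:E <= hausdorff_dim (F xi))%E.
  by apply: le_trans sdimE _; exact/le_hausdorff_dim/EF.
have slowF xi : (s%:E <= lower_box_dim (F xi))%E by exact: lower_box_dim_ge.
have boxF r : has_box_dim (F (ratr r)) s%:E.
  have upF : (upper_box_dim (F (ratr r)) <= s%:E)%E.
    by rewrite sE; apply: upper_box_dim_rat => //; exact: ltW.
  have lu := lower_le_upper_box_dim (F (ratr r)).
  split; apply/eqP; rewrite eq_le.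
    by rewrite (le_trans lu upF)/=.
  by rewrite upF (le_trans (slowF _) lu).
have boxE : has_box_dim E s%:E by have := boxF 0; rewrite rmorph0 F0.
have dimF xi : lower_box_dim (F xi) = s%:E -> hausdorff_dim (F xi) = s%:E.
  move=> Fs; apply/eqP; rewrite eq_le sdimF andbT.
  by apply: hausdorff_dim_le_lower_box_dim; rewrite ?Fs// ltW.
have dimE : hausdorff_dim E = s%:E.
  by rewrite -F0; apply: dimF; rewrite F0; have [] := boxE.
have dim2 : hausdorff_dim (F (Num.sqrt 2)) != s%:E.
  (* Any exponent strictly between [u] and [u + v] would serve. *)
  rewrite gt_eqF//; apply: (@lt_le_trans _ _ (d%:R * (u + v / 2))%:E).
    by rewrite lte_fin sE ltr_pM2l//; lra.
  apply: spread_hausdorff_dim => //; first exact: compact_lin_sum.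
    by lra.
  by apply: (spread_lin_sum_sqrt2 lmK ml mS wlm); lra.
have [x [y [xP yP xy]]] := superapprox_decomp K (Num.sqrt 2 : R).
have lowS xi : superapprox K xi -> lower_box_dim (F xi) = s%:E.
  move=> xiP; apply/eqP; rewrite eq_le slowF andbT sE.
  by apply: lower_box_dim_superapprox => //; exact: ltW.
exists E; split => //; first exact: compact_cube.
  move=> z Ez i; have := gset_bound (Ez i).
  by rewrite /level big_ord0 expr0.
have [lowE upE] := boxE.
split.
- by move=> _ [r _ <-]; exists s%:E; split; rewrite ?FE.
(* Equal box dimensions at [sqrt 2] would give lower box dimension [s], hence Hausdorff dimension
   [s], contradicting [dim2]. *)
- split => // /(_ (Num.sqrt 2) I)[t [[low2 _] [lowEt _]]].
  move: dim2 => /eqP; apply; apply: dimF.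
  by rewrite -FE low2 -lowEt.
(* [x] and [y] belong to the set but their sum [sqrt 2] does not; for the lower box dimension the
   contradiction again passes through [dimF]. *)
- move=> Sf; have /= := is_subfieldD (x := x) (y := y) Sf.
  rewrite !FE dimE xy => /(_ (dimF _ (lowS _ xP)) (dimF _ (lowS _ yP))).
  exact/eqP.
- move=> Sf; have /= := is_subfieldD (x := x) (y := y) Sf.
  rewrite !FE lowE xy => /(_ (lowS _ xP) (lowS _ yP)) /dimF.
  exact/eqP.
Qed.
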